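(* Let $q\in\mathbb C^*$ and let $M$ be a $\mathcal B(q)$-module that is free of rank one as a $U(\mathfrak h)$-module, where $\mathfrak h=\mathbb CL_{0,0}\oplus\mathbb CW_{0,0}$. Then $M$ is isomorphic, as a $\mathcal B(q)$-module, to one of the following modules for some $\lambda\in\mathbb C^*$, $\alpha,a,b\in\mathbb C$, $\beta,\gamma\in\mathbb C^2$, $\mathbf h(\alpha)\in\mathcal T_\alpha$ (respectively $\mathbf h(0)\in\mathcal T_0$): - $\Omega(\lambda,\alpha,\mathbf h(\alpha))$, if $-2q\notin\mathbb N$; - $\Omega_n(\lambda,a,b,\mathbf h(0))$, if $q=\frac1n$ for some $n\in\mathbb Z_+$; - $\Omega(\lambda,\alpha,\gamma,\mathbf h(\alpha))$, if $-2q\in\mathbb N$ and $q\neq-1$; - $\Omega(\lambda,\alpha,\beta,\gamma,\mathbf h(\alpha))$, if $q=-1$. (When $q=\frac1n$ the first two conditions both hold, and $M$ is isomorphic to a module from one of the first two families.)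
   Context: $\mathbb N=\{0,1,2,\dots\}$, $\mathbb Z_+=\{1,2,\dots\}$, $\mathbb C^*=\mathbb C\setminus\{0\}$. For $q\in\mathbb C^*$, the Takiff Block type Lie algebra $\mathcal B(q)$ is the complex Lie algebra with basis $\{L_{m,i},W_{m,i},C_1,C_2\mid (m,i)\in\mathbb Z\times\mathbb N\}$, with $C_1,C_2$ central and $[L_{m,i},L_{n,j}]=(n(i+q)-m(j+q))L_{m+n,i+j}+\frac{m^3-m}{12}\delta_{i+j,0}\delta_{m+n,0}C_1$, $[L_{m,i},W_{n,j}]=(n(i+q)-m(j+q))W_{m+n,i+j}+\frac{m^3-m}{12}\delta_{i+j,0}\delta_{m+n,0}C_2$, $[W_{m,i},W_{n,j}]=0$. For $k\in\mathbb N$, $n\in\mathbb Z$, $\alpha\in\mathbb C$ put $h_{n,k;\alpha}(t)=nt^k-n(n-1)\alpha\frac{t^k-\alpha^k}{t-\alpha}\in\mathbb C[t]$. $\mathcal T_\alpha$ is the set of all families $\mathbf h=\{h_m(t)\mid m\in\mathbb Z\}$ of polynomials of the form $h_m(t)=\sum_{i\ge0}\xi_ih_{m,i;\alpha}(t)$ with $\xi_i\in\mathbb C$ independent of $m$ and all but finitely many zero. For $\mathbf h\in\mathcal T_\alpha$ and $c\in\mathbb C$ put $\Theta_{\mathbf h,c}(t)=c\,\frac{h_1(-t)-h_1(\alpha)}{-t-\alpha}\in\mathbb C[t]$. For $\beta=(\beta_1,\beta_2)$, $\gamma=(\gamma_1,\gamma_2)$, $\mathbf h=\{h_m\}\in\mathcal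 T_\alpha$, the $\mathcal B(q)$-module $\Omega(\lambda,\alpha,\beta,\gamma,\mathbf h)$ is $\mathbb C[t,s]$ with $C_1,C_2$ acting by $0$ and, for $(m,i)\in\mathbb Z\times\mathbb N$, $L_{m,i}f(t,s)=\delta_{i,0}\lambda^m(s+qh_m(q^{-1}t))f(t,s-mq)-\delta_{i,0}m\lambda^mq(t-mq\alpha)\frac{\partial}{\partial t}f(t,s-mq)+\delta_{m,0}\delta_{i,-2q}\gamma_2f(t,s)+\delta_{i,1}\delta_{q,-1}\lambda^m\big(\beta_2+m\Theta_{\mathbf h,\beta_1}(t)+m\beta_1\frac{\partial}{\partial t}\big)f(t,s+m)$, $W_{m,i}f(t,s)=\delta_{i,0}\lambda^m(t-mq\alpha)f(t,s-mq)+\delta_{m,0}\delta_{i,-2q}\gamma_1f(t,s)+\delta_{i,1}\delta_{q,-1}\beta_1\lambda^mf(t,s+m)$. Shorthand: if $-2q\notin\mathbb N$, $\Omega(\lambda,\alpha,\mathbf h):=\Omega(\lambda,\alpha,0,0,\mathbf h)$; if $-2q\in\mathbb N$ and $q\ne-1$, $\Omega(\lambda,\alpha,\gamma,\mathbf h):=\Omega(\lambda,\alpha,0,\gamma,\mathbf h)$. For $q=\frac1n$ ($n\in\mathbb Z_+$) and $\mathbf h(0)=\{h_m\}\in\mathcal T_0$, the $\mathcal B(\frac1n)$-module $\Omega_n(\lambda,a,b,\mathbf h(0))$ is $\mathbb C[t,s]$ with $C_1,C_2$ acting by $0$ and, for $(m,i)\in\mathbb Z\times\mathbb N$, $L_{m,i}f(t,s)=\lambda^ma^it^{in}\big((1+in)s+\frac1nh_m(nt)-mi\big)f(t,s-\frac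 mn)+ib\lambda^ma^{i-1}t^{1+in}f(t,s-\frac mn)-\frac mn\lambda^ma^it^{1+in}\frac{\partial}{\partial t}f(t,s-\frac mn)$, $W_{m,i}f(t,s)=\lambda^ma^it^{1+in}f(t,s-\frac mn)$, with the conventions $a^0=1$ (also for $a=0$) and $iba^{i-1}=0$ for $i=0$. *)

(* Defs.v *)
(* The complex numbers are R[i], for R an arbitrary model of the real numbers. *)
From HB Require Import structures.
From mathcomp Require Import all_boot all_order all_algebra.
From mathcomp Require Import finmap reals complex monalg.
From mathcomp Require Import ring.

Set Implicit Arguments.
Unset Strict Implicit.
Unset Printing Implicit Defensive.

Import Order.TTheory GRing.Theory Num.Theory.

Local Open Scope ring_scope.

Record lieAlgebra (K : fieldType) := LieAlgebra {
  lie_sort :> lmodType K;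
  lie_br : lie_sort -> lie_sort -> lie_sort;
  lie_linearl : forall y, linear (fun x => lie_br x y);
  lie_linearr : forall x, linear (lie_br x);
  lie_alt : forall x, lie_br x x = 0;
  lie_jacobi : forall x y z,
    lie_br x (lie_br y z) + lie_br y (lie_br z x) + lie_br z (lie_br x y) = 0
}.

Definition is_lie_module (K : fieldType) (g : lieAlgebra K) (V : lmodType K)
    (act : g -> V -> V) : Prop :=
  [/\ forall v, linear (fun x => act x v),
      forall x, linear (act x)
    & forall x y v, act (lie_br x y) v = act x (act y v) - act y (act x v)].

(* Linear extension to the free module {malg K[I]} of a map defined on its
   basis I. *)
Definition linext (K : fieldType) (I : choiceType) (V : lmodType K)
    (f : I -> V) (x : {malg K[I]}) : V :=
  \sum_(k <- msupp x) x@_k *: f k.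

Section LinExt.
Context (K : fieldType) (I : choiceType).
Implicit Types (V W : lmodType K) (x y : {malg K[I]}).

Lemma linear_comb V W (f : {linear V -> W}) (a b : K) u v :
  f v = 0 -> f (a *: u + b *: v) = a *: f u.
Proof. by move=> fv; rewrite linearD !linearZ /= fv scaler0 addr0. Qed.

Lemma linextEw V (f : I -> V) x (d : {fset I}) :
  fsubset (msupp x) d -> linext f x = \sum_(k <- d) x@_k *: f k.
Proof.
move=> le; rewrite /linext.
apply: (@big_fset_incl _ _ _ _ _ d (fun k => x@_k *: f k)) => // k _ kx.
by rewrite (mcoeff_outdom kx) scale0r.
Qed.

Lemma linext_linear V (f : I -> V) : linear (linext f).
Proof.
move=> a x y; pose d := fsetU (msupp x) (msupp y).
have sx : fsubset (msupp x) d by apply: fsubsetUl.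
have sy : fsubset (msupp y) d by apply: fsubsetUr.
have sz : fsubset (msupp (a *: x + y)) d.
  apply: fsubset_trans (msuppD_le _ _) _; rewrite fsubUset sy andbT.
  exact: fsubset_trans (msuppZ_le _ _) sx.
rewrite (linextEw f sx) (linextEw f sy) (linextEw f sz) scaler_sumr -big_split.
by apply: eq_bigr => k _ /=; rewrite mcoeffD mcoeffZ scalerDl scalerA.
Qed.

HB.instance Definition _ V (f : I -> V) :=
  GRing.isLinear.Build K {malg K[I]} V *:%R (linext f) (linext_linear f).

Lemma linextU V (f : I -> V) k : linext f << k >> = f k.
Proof.
rewrite (linextEw f (msuppU_le (k := k) (x := 1))) big_seq_fset1.
by rewrite mcoeffUU scale1r.
Qed.

Lemma malg_linP V (f g : {malg K[I]} -> V) : linear f -> linear g ->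
  (forall k, f << k >> = g << k >>) -> f =1 g.
Proof.
have ext (h : {malg K[I]} -> V) : linear h ->
    forall x, h x = \sum_(k <- msupp x) x@_k *: h << k >>.
  move=> lh x; have hD : {morph h : u v / u + v}.
    by move=> u v; have := lh 1 u v; rewrite !scale1r.
  have h0 : h 0 = 0 by have := lh (-1) 0 0; rewrite scaler0 addr0 scaleN1r addNr.
  rewrite {1}(monalgE x) (big_morph h hD h0); apply: eq_bigr => k _.
  have -> : << x@_k *g k >> = x@_k *: << k >> :> {malg K[I]}.
    by apply/malgP => l; rewrite mcoeffZ !mcoeffU mulrnAr mulr1.
  by have := lh x@_k << k >> 0; rewrite h0 !addr0.
move=> lf lg e x; rewrite (ext f lf) (ext g lg).
by apply: eq_bigr => k _; rewrite e.
Qed.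
End LinExt.

(* The basis L_{m,i}, W_{m,i}, C_1, C_2 of B(q). *)
Inductive block_idx :=
  IL of int & nat | IW of int & nat | IC1 | IC2.

Definition block_idx_enc (k : block_idx) : (int * nat) + (int * nat) + bool :=
  match k with
  | IL m i => inl (inl (m, i))
  | IW m i => inl (inr (m, i))
  | IC1 => inr true
  | IC2 => inr false
  end.

Definition block_idx_dec (u : (int * nat) + (int * nat) + bool) : block_idx :=
  match u with
  | inl (inl (m, i)) => IL m i
  | inl (inr (m, i)) => IW m i
  | inr true => IC1
  | inr false => IC2
  end.

Lemma block_idx_encK : cancel block_idx_enc block_idx_dec.
Proof. by case. Qed.

HB.instance Definition _ := Countable.copy block_idx (can_type block_idx_encK).

Section TakiffBlock.
Context (R : realType).
Local Notation C := R[i].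
Local Notation B := {malg C[block_idx]}.
Implicit Types (q : C) (m n : int) (i j : nat).

Definition block_coef q m i n j : C :=
  n%:~R * (i%:R + q) - m%:~R * (j%:R + q).

Definition block_cocycle m i n j : C :=
  (m ^+ 3 - m)%:~R / 12%:R * ((i + j == 0)%N && (m + n == 0))%:R.

Definition block_br0 q (k l : block_idx) : B :=
  match k, l with
  | IL m i, IL n j =>
      block_coef q m i n j *: << IL (m + n) (i + j)%N >>
      + block_cocycle m i n j *: << IC1 >>
  | IL m i, IW n j =>
      block_coef q m i n j *: << IW (m + n) (i + j)%N >>
      + block_cocycle m i n j *: << IC2 >>
  | IW n j, IL m i =>
      - (block_coef q m i n j *: << IW (m + n) (i + j)%N >>
         + block_cocycle m i n j *: << IC2 >>)
  | _, _ => 0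
  end.

Definition block_br q (x y : B) : B :=
  linext (fun k => linext (fun l => block_br0 q k l) y) x.

Lemma block_brU q k l : block_br q << k >> << l >> = block_br0 q k l.
Proof. by rewrite /block_br !linextU. Qed.

Lemma block_linearl q y : linear (fun x => block_br q x y).
Proof. exact: linext_linear. Qed.

Lemma block_linearr q x : linear (block_br q x).
Proof.
move=> a y z; rewrite /block_br /linext scaler_sumr -big_split /=.
apply: eq_bigr => k _; rewrite -!/(linext _ _) linearP scalerDr !scalerA.
by rewrite mulrC.
Qed.

Lemma block_coefN q m i n j : block_coef q m i n j = - block_coef q n j m i.
Proof. by rewrite /block_coef; ring. Qed.

Lemma block_cocycleN m i n j : block_cocycle m i n j = - block_cocycle n j m i.
Proof.
rewrite /block_cocycle [(j + i)%N]addnC [n + m]addrC.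
have [|_] := boolP (m + n == 0); last by rewrite andbF !mulr0 oppr0.
rewrite addr_eq0 => /eqP ->; rewrite -!mulNr -rmorphN /=.
by congr (_%:~R / _ * _); ring.
Qed.

Lemma block_br0_anti q k l : block_br0 q k l = - block_br0 q l k.
Proof.
case: k l => [m i|m i||] [n j|n j||] /=; rewrite ?oppr0 ?opprK //.
by rewrite block_coefN block_cocycleN [m + n]addrC [(i + j)%N]addnC !scaleNr
  opprD.
Qed.

Lemma block_br_anti q x y : block_br q x y = - block_br q y x.
Proof.
have e1 : linear (fun u => - block_br q y u).
  by move=> a u v; rewrite block_linearr opprD scalerN.
apply: (malg_linP (@block_linearl q y) e1) => k /=.
have e2 : linear (fun u => - block_br q u << k >>).
  by move=> a u v; rewrite (block_linearl _ _ a) opprD scalerN.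
apply: (malg_linP (@block_linearr q _) e2) => l /=.
by rewrite !block_brU block_br0_anti.
Qed.

Lemma block_alt q x : block_br q x x = 0.
Proof.
have e : block_br q x x + block_br q x x = 0.
  by rewrite {1}block_br_anti addNr.
have /eqP := e; rewrite -mulr2n -scaler_nat scaler_eq0 pnatr_eq0 /=.
by move/eqP.
Qed.

Local Opaque block_br.

HB.instance Definition _ q x :=
  GRing.isLinear.Build C B B *:%R (block_br q x) (block_linearr q x).

Lemma block_brL q k l p : block_br q << k >> (block_br0 q l p) =
  match l, p with
  | IL n j, IL r h => block_coef q n j r h *: block_br0 q k (IL (n + r) (j + h)%N)
  | IL n j, IW r h => block_coef q n j r h *: block_br0 q k (IW (n + r) (j + h)%N)
  | IW r h, IL n j =>
      - (block_coef q n j r h *: block_br0 q k (IW (n + r) (j + h)%N))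
  | _, _ => 0
  end.
Proof.
have z1 : block_br0 q k IC1 = 0 by case: (k).
have z2 : block_br0 q k IC2 = 0 by case: (k).
have brk (a b : C) (l' : block_idx) c : block_br0 q k c = 0 ->
    block_br q << k >> (a *: << l' >> + b *: << c >>) = a *: block_br0 q k l'.
  by move=> ck; rewrite linear_comb /= block_brU.
case: l p => [n j|n j||] [r h|r h||]; rewrite [in LHS]/block_br0.
- exact: brk.
- exact: brk.
- exact: linear0.
- exact: linear0.
- by rewrite (linearN (block_br q << k >>)); congr (- _); exact: brk.
all: exact: linear0.
Qed.

Lemma block_jacobi_coef (V : lmodType C) q m i n j r h (X Z : V) :
  block_coef q n j r h *: (block_coef q m i (n + r) (j + h)%N *: X
    + block_cocycle m i (n + r) (j + h)%N *: Z)
  + block_coef q r h m i *: (block_coef q n j (r + m) (h + i)%N *: X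
    + block_cocycle n j (r + m) (h + i)%N *: Z)
  + block_coef q m i n j *: (block_coef q r h (m + n) (i + j)%N *: X
    + block_cocycle r h (m + n) (i + j)%N *: Z) = 0.
Proof.
have c3 a b c d e f : a *: X + b *: Z + (c *: X + d *: Z) + (e *: X + f *: Z)
    = (a + c + e) *: X + (b + d + f) *: Z.
  by rewrite !scalerDl (addrACA (a *: X)) (addrACA (a *: X + _)).
rewrite !scalerDr !scalerA c3.
rewrite [X in X *: _](_ : _ = 0); last first.
  by rewrite /block_coef !natrD !rmorphD /=; ring.
rewrite scale0r add0r [X in X *: _](_ : _ = 0) ?scale0r //.
have -> : block_cocycle n j (r + m) (h + i) =
    (n ^+ 3 - n)%:~R / 12%:R * ((i + (j + h) == 0)%N && (m + (n + r) == 0))%:R.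
  by rewrite /block_cocycle addnA [(j + h + i)%N]addnC addrA [n + r + m]addrC.
have -> : block_cocycle r h (m + n) (i + j) =
    (r ^+ 3 - r)%:~R / 12%:R * ((i + (j + h) == 0)%N && (m + (n + r) == 0))%:R.
  by rewrite /block_cocycle addnC -addnA [r + _]addrC -addrA.
rewrite /block_cocycle; case: andP => [[]|_]; last by rewrite !mulr0 !addr0.
rewrite !addn_eq0 => /and3P[/eqP-> /eqP-> /eqP->].
rewrite addrC addr_eq0 => /eqP mE; have -> : m = - (n + r) by rewrite mE opprK.
rewrite /block_coef !rmorphB !rmorphN !rmorphXn /= !rmorphN !rmorphD /=.
by field.
Qed.

Definition block_jac q k l p : B :=
  block_br q << k >> (block_br0 q l p) + block_br q << l >> (block_br0 q p k)
  + block_br q << p >> (block_br0 q k l).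

Lemma block_jacobi0 q k l p : block_jac q k l p = 0.
Proof.
have main := @block_jacobi_coef B q.
have zA (x y z : int) : (y + (z + x) = x + (y + z)) * (z + (x + y) = x + (y + z)).
  by rewrite addrA addrC [z + _]addrC addrA.
have nA (x y z : nat) : 
    (y + (z + x) = x + (y + z))%N * (z + (x + y) = x + (y + z))%N.
  by rewrite addnA addnC [(z + _)%N]addnC addnA.
pose J := block_jac q.
have rot (a b c : B) : a + b + c = b + c + a by rewrite -addrA addrC.
have cyc k' l' p' : J k' l' p' = J l' p' k' by exact: rot.
have add3 (a b c a' b' c' : B) :
    a = a' -> b = b' -> c = c' -> a' + b' + c' = 0 -> a + b + c = 0.
  by move=> -> -> ->.
have JE k' l' p' := add3 _ _ _ _ _ _ (block_brL q k' l' p')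
  (block_brL q l' p' k') (block_brL q p' k' l').
have JL m i n j r h : J (IL m i) (IL n j) (IL r h) = 0.
  apply: JE; rewrite /block_br0 (zA m n r).1 (nA i j h).1 (zA m n r).2 (nA i j h).2.
  exact: main.
have JW m i n j r h : J (IL m i) (IL n j) (IW r h) = 0.
  apply: JE; rewrite /block_br0 [block_coef q m i r h]block_coefN scaleNr opprK.
  rewrite [block_coef q (m + n) _ _ _]block_coefN.
  rewrite [block_cocycle (m + n) _ _ _]block_cocycleN !scaleNr -opprD opprK.
  rewrite [m + r]addrC [(i + h)%N]addnC (zA m n r).1 (nA i j h).1.
  rewrite [m + n + r]addrC [(i + j + h)%N]addnC (zA m n r).2 (nA i j h).2.
  exact: main.
case: k l p => [m i|m i||] [n j|n j||] [r h|r h||].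
all: lazymatch goal with
  | |- block_jac _ (IL _ _) (IL _ _) (IL _ _) = _ => exact: JL
  | |- block_jac _ (IL _ _) (IL _ _) (IW _ _) = _ => exact: JW
  | |- block_jac _ (IL _ _) (IW _ _) (IL _ _) = _ => 
      exact: etrans (esym (cyc _ _ _)) (JW _ _ _ _ _ _)
  | |- block_jac _ (IW _ _) (IL _ _) (IL _ _) = _ => 
      exact: etrans (cyc _ _ _) (JW _ _ _ _ _ _)
  | _ => apply: JE; rewrite /block_br0 ?(scaler0, oppr0, addr0); reflexivity
  end.
Qed.

Lemma block_jacobi q x y z :
  block_br q x (block_br q y z) + block_br q y (block_br q z x)
  + block_br q z (block_br q x y) = 0.
Proof.
pose J x y z := block_br q x (block_br q y z) + block_br q y (block_br q z x)
  + block_br q z (block_br q x y).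
have rot (a b c : B) : a + b + c = b + c + a by rewrite -addrA addrC.
have Jc u v w : J u v w = J v w u by exact: rot.
have add3 (a : C) (x1 x2 x3 y1 y2 y3 z1 z2 z3 : B) : x1 = a *: y1 + z1 ->
    x2 = a *: y2 + z2 -> x3 = a *: y3 + z3 ->
    x1 + x2 + x3 = a *: (y1 + y2 + y3) + (z1 + z2 + z3).
  move=> -> -> ->; rewrite !scalerDr (addrACA (a *: y1)).
  exact: (addrACA (a *: y1 + a *: y2)).
have lJ v w : linear (fun u => J u v w).
  move=> a u u'.
  have e1 := block_linearl q (block_br q v w) a u u'.
  have e2 := etrans (congr1 (block_br q v) (block_linearr q w a u u'))
    (block_linearr q v a _ _).
  have e3 := etrans (congr1 (block_br q w) (block_linearl q v a u u'))
    (block_linearr q w a _ _).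
  exact: add3 e1 e2 e3.
have l0 : linear (fun _ : B => 0 : B) by move=> a u v; rewrite scaler0 addr0.
apply: (malg_linP (lJ y z) l0) => k; rewrite Jc.
apply: (malg_linP (lJ z _) l0) => l; rewrite Jc.
apply: (malg_linP (lJ _ _) l0) => p.
by rewrite /J !block_brU; exact: block_jacobi0.
Qed.

Definition takiff_block q : lieAlgebra C :=
  LieAlgebra (@block_linearl q) (@block_linearr q) (@block_alt q)
    (@block_jacobi q).

End TakiffBlock.

Section Modules.
Context (R : realType).
Local Notation C := R[i].
Implicit Types (q c lambda alpha a b : C) (m : int) (i j k : nat).

(* C[t,s] is C[t][s]: the outer indeterminate is s, the inner one is t. *)
Definition Cts : comNzRingType := {poly {poly C}}.
Definition cst c : Cts := c%:P%:P.
Definition in_t (p : {poly C}) : Cts := p%:P.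
Definition t_ : Cts := in_t 'X.
Definition s_ : Cts := 'X.

(* f(t, s) |-> f(t, s - c) *)
Definition shift c (f : Cts) : Cts := f \Po (s_ - cst c).
Definition ddt (f : Cts) : Cts := map_poly (fun p : {poly C} => p^`()) f.

(* The subalgebra h = C L_{0,0} + C W_{0,0} of B(q) is abelian, so that its
   enveloping algebra U(h) is the polynomial algebra C[t,s], with
   L_{0,0} = s and W_{0,0} = t; the next two lemmas are the universal property:
   a Lie algebra morphism from h to an associative algebra A is a pair of
   commuting elements of A. *)
Lemma block_abelian q :
  block_br q << IL 0 0 >> << IW 0 0 >> = 0 :> {malg C[block_idx]}.
Proof.
rewrite block_brU /= /block_coef /block_cocycle !mul0r subrr scale0r add0r.
exact: scale0r.
Qed.

Lemma Cts_enveloping (A : algType C) (x y : A) : x * y = y * x ->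
  exists g : {rmorphism Cts -> A},
    [/\ forall c, g (cst c) = c%:A, g s_ = x & g t_ = y] /\
    forall g' : {rmorphism Cts -> A},
      [/\ forall c, g' (cst c) = c%:A, g' s_ = x & g' t_ = y] -> g' =1 g.
Proof.
move=> cxy.
have cx : commr_rmorph (horner_alg y : {poly C} -> A) x.
  elim/poly_ind => [|p c IH]; first by rewrite rmorph0; apply: commr0.
  rewrite rmorphD rmorphM /= horner_algX horner_algC.
  apply: commrD; first by apply: commrM.
  by rewrite /GRing.comm mulr_algl mulr_algr.
pose g : {rmorphism Cts -> A} := horner_morph cx.
exists g; split=> [|g' [gc gs gt] u].
  split=> [c||]; first by rewrite /g /= horner_morphC /= horner_algC.
  - by rewrite /g /= horner_morphX.
  - by rewrite /g /= horner_morphC /= horner_algX.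
have e p : g' (in_t p) = horner_alg y p.
  elim/poly_ind: p => [|p c IH]; first by rewrite /in_t !rmorph0.
  have -> : in_t (p * 'X + c%:P) = in_t p * t_ + cst c.
    by rewrite /in_t polyCD polyCM.
  rewrite (rmorphD g') (rmorphM g') IH gt gc.
  by rewrite rmorphD rmorphM /= horner_algX horner_algC.
rewrite /g; elim/poly_ind: u => [|u p IH]; first by rewrite !rmorph0.
have -> : u * 'X + p%:P = u * s_ + in_t p :> Cts by [].
rewrite (rmorphD g') (rmorphM g') IH gs e rmorphD rmorphM /=.
by rewrite horner_morphX horner_morphC.
Qed.

(* The action on a B(q)-module of an element of U(h). *)
Definition Uh_act (V : lmodType C) (act : {malg C[block_idx]} -> V -> V)
    (u : Cts) (v : V) : V :=
  \sum_(i < size u) \sum_(j < size u`_i)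
    u`_i`_j *: iter i (act << IL 0 0 >>) (iter j (act << IW 0 0 >>) v).

Definition Uh_free_rank1 (V : lmodType C)
    (act : {malg C[block_idx]} -> V -> V) : Prop :=
  exists v0 : V, bijective (fun u => Uh_act act u v0).

(* h_{n,k;alpha}(t); the division by t - alpha is exact. *)
Definition hpoly alpha (n : int) k : {poly C} :=
  n%:~R *: 'X^k
  - ((n * (n - 1))%:~R * alpha) *:
      (('X^k - (alpha ^+ k)%:P) %/ ('X - alpha%:P)).

Definition Tset alpha (h : int -> {poly C}) : Prop :=
  exists (N : nat) (xi : nat -> C),
    forall m, h m = \sum_(i < N) xi i *: hpoly alpha m i.

(* Theta_{h,c}(t); the division by - t - alpha is exact. *)
Definition Theta alpha (h : int -> {poly C}) c : {poly C} :=
  c *: ((h 1 \Po (- 'X) - ((h 1).[alpha])%:P) %/ (- 'X - alpha%:P)).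

Definition Omega q lambda alpha (beta gamma : C * C) (h : int -> {poly C})
    (k : block_idx) (f : Cts) : Cts :=
  match k with
  | IL m i =>
      cst ((i == 0%N)%:R * lambda ^ m)
        * (s_ + cst q * in_t (h m \Po (q^-1 *: 'X))) * shift (m%:~R * q) f
      - cst ((i == 0%N)%:R * m%:~R * lambda ^ m * q)
        * (t_ - cst (m%:~R * q * alpha)) * ddt (shift (m%:~R * q) f)
      + cst ((m == 0)%:R * (i%:R == - (2%:R * q))%:R * gamma.2) * f
      + cst ((i == 1%N)%:R * (q == - 1)%:R * lambda ^ m)
        * (cst beta.2 * shift (- m%:~R) f
           + cst m%:~R * in_t (Theta alpha h beta.1) * shift (- m%:~R) f
           + cst (m%:~R * beta.1) * ddt (shift (- m%:~R) f))
  | IW m i =>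
      cst ((i == 0%N)%:R * lambda ^ m)
        * (t_ - cst (m%:~R * q * alpha)) * shift (m%:~R * q) f
      + cst ((m == 0)%:R * (i%:R == - (2%:R * q))%:R * gamma.1) * f
      + cst ((i == 1%N)%:R * (q == - 1)%:R * beta.1 * lambda ^ m)
        * shift (- m%:~R) f
  | IC1 | IC2 => 0
  end.

(* Omega_n; for i = 0 the coefficient i b a^(i - 1) vanishes. *)
Definition Omega_n (n : nat) lambda a b (h : int -> {poly C})
    (k : block_idx) (f : Cts) : Cts :=
  match k with
  | IL m i =>
      cst (lambda ^ m * a ^+ i) * t_ ^+ (i * n)%N
        * (cst (1 + (i * n)%N%:R) * s_
           + cst n%:R^-1 * in_t (h m \Po (n%:R *: 'X)) - cst (m%:~R * i%:R))
        * shift (m%:~R / n%:R) f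
      + cst (i%:R * b * lambda ^ m * a ^+ i.-1) * t_ ^+ (1 + i * n)%N
        * shift (m%:~R / n%:R) f
      - cst (m%:~R / n%:R * lambda ^ m * a ^+ i) * t_ ^+ (1 + i * n)%N
        * ddt (shift (m%:~R / n%:R) f)
  | IW m i =>
      cst (lambda ^ m * a ^+ i) * t_ ^+ (1 + i * n)%N * shift (m%:~R / n%:R) f
  | IC1 | IC2 => 0
  end.

(* The module (V, act) is isomorphic to C[t,s] with the basis of B(q) acting
   by Om. *)
Definition iso_Cts (V : lmodType C) (act : {malg C[block_idx]} -> V -> V)
    (Om : block_idx -> Cts -> Cts) : Prop :=
  exists phi : V -> Cts,
    [/\ bijective phi,
        forall c u v, phi (c *: u + v) = cst c * phi u + phi v
      & forall x v,
          phi (act x v) = \sum_(k <- msupp x) cst x@_k * Om k (phi v)].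

End Modules.

(* Main.v *)
(* Let [M] be free over [U(h) = C[t,s]].  The relations with [L_{0,0} = s] and
   [W_{0,0} = t] make [W_{m,i}] the shift [s |-> s - mq] followed by
   multiplication by a polynomial [w_{m,i}], and [L_{m,i}] the analogous operator
   with an additional derivation in [t].  The polynomial
   [w_{1,0}(s) w_{-1,0}(s - q)] is [q]-periodic in [s] because [W_{1,0}] and
   [W_{-1,0}] commute, so [w_{1,0}] lies in [C[t]]; then every [w_{m,i}] does, and
   [L_{m,i} 1 = s A_{m,i}(t) + B_{m,i}(t)].

   What remains are differential-difference equations in [C[t]].  At level
   [i = 0] a degree count gives [w_{1,0} = lambda (t - x)] with [x = q alpha], and
   the equations for [(m,n)] with [n = 1, -1] then determine everything from
   [lambda], [x] and [B_{1,0}].  At level [i > 0] the [w_{m,i}], and the [B_{m,i}]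
   up to a particular solution, satisfy one homogeneous equation, whose solutions
   are zero, constants when [i = -q], constants supported at [m = 0] when
   [i = -2q], and monomials [t^(1 + i/q)] when [x = 0] and [i/q] is a positive
   integer.  Brackets of level [1] with level [i - 1] tie the levels together. *)
Require Import Defs.
From mathcomp Require Import all_boot all_order all_algebra.
From mathcomp Require Import boolp reals complex monalg.
From mathcomp Require Import ring zify.

Set Implicit Arguments.
Unset Strict Implicit.
Unset Printing Implicit Defensive.

Import GRing.Theory Num.Theory.

Local Open Scope ring_scope.

(** [lincomb1], [lincomb2] and [lincomb3] deduce an equation from known ones: the difference of its
    sides is written as a combination of theirs, and that identity is left to [ring]. *)
Lemma lincomb1 (A : pzRingType) (c a b x y : A) :
  a = b -> x - y = c * (a - b) -> x = y.
Proof. by move=> -> /eqP; rewrite subrr mulr0 subr_eq0 => /eqP. Qed.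

Lemma lincomb2 (A : pzRingType) (c d a b a' b' x y : A) :
  a = b -> a' = b' -> x - y = c * (a - b) + d * (a' - b') -> x = y.
Proof. by move=> -> -> /eqP; rewrite !subrr !mulr0 addr0 subr_eq0 => /eqP. Qed.

Lemma lincomb3 (A : pzRingType) (c d e a b a' b' a'' b'' x y : A) :
  a = b -> a' = b' -> a'' = b'' ->
  x - y = c * (a - b) + d * (a' - b') + e * (a'' - b'') -> x = y.
Proof.
by move=> -> -> -> /eqP; rewrite !subrr !mulr0 !addr0 subr_eq0 => /eqP.
Qed.

(** * Polynomials in characteristic zero *)

Section PolyDeriv.
Context (K : numFieldType).
Implicit Types (p f g : {poly K}) (a c x : K) (m n : int).

Lemma deriv_intr m : (m%:~R : {poly K})^`() = 0.
Proof. by rewrite -(rmorph_int (@polyC K)) derivC. Qed.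

Lemma deriv_natr (k : nat) : (k%:R : {poly K})^`() = 0.
Proof. exact: deriv_intr k. Qed.

Lemma deriv_eq0 f : f^`() = 0 -> f = (f`_0)%:P.
Proof.
move=> f0; apply/polyP => -[|i]; rewrite coefC //=.
have /eqP := congr1 (fun p => p`_i) f0.
by rewrite coef_deriv coef0 mulrn_eq0 /= => /eqP.
Qed.

Lemma poly_intr_eq0 m : ((m%:~R : {poly K}) == 0) = (m == 0).
Proof. by rewrite -(rmorph_int (@polyC K)) polyC_eq0 intr_eq0. Qed.

(* The equation says that [('X - a)^+k.+1 * f] has derivative zero. *)
Lemma euler_inj k a f :
  k.+1%:R * f + ('X - a%:P) * f^`() = 0 -> f = 0.
Proof.
move=> e; set F := ('X - a%:P) ^+ k.+1 * f.
have F0 : F^`() = 0.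
  rewrite /F derivM derivCE derivXsubC mul1r /=.
  apply: (lincomb1 (c := ('X - a%:P) ^+ k) e).
  by rewrite exprS -mulr_natr; ring.
have Fa : F.[a] = 0.
  by rewrite /F hornerM horner_exp hornerXsubC subrr exprS !mul0r.
have /eqP : F = 0.
  by have FE := deriv_eq0 F0; move: Fa; rewrite {1}FE hornerC => Fa; rewrite FE Fa.
by rewrite mulf_eq0 expf_eq0 polyXsubC_eq0 /= => /eqP.
Qed.

(** Periodicity gives [f] the value [f.[0]] at every [- (k c)]. These points are pairwise distinct,
    so [f - f.[0]] would have too many roots for a nonzero polynomial. *)
Lemma polyC_periodic (A : idomainType) (c : A) (f : {poly A}) :
  (forall k : nat, k.+1%:R * c != 0) -> f \Po ('X - c%:P) = f ->
  f = (f`_0)%:P.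
Proof.
move=> c0 fc.
have fE (k : nat) : f.[- (k%:R * c)] = f.[0].
  elim: k => [|k IH]; first by rewrite mul0r oppr0.
  rewrite -IH -[in RHS]fc horner_comp hornerXsubC; congr _.[_]; ring.
have [//|f0] := eqVneq f (f`_0)%:P.
have g0 : f - (f`_0)%:P != 0 by rewrite subr_eq0.
have := max_poly_roots g0
  (rs := [seq - (k%:R * c) | k <- iota 0 (size (f - (f`_0)%:P))]).
rewrite size_map size_iota ltnn => H; suff: false by []; apply: H.
  apply/allP => y /mapP[k _ ->].
  by rewrite rootE hornerD hornerN hornerC fE horner_coef0 subrr.
rewrite map_inj_uniq ?iota_uniq // => i j /oppr_inj.
wlog ij : i j / (i <= j)%N.
  by case: (leqP i j) => [le /(_ _ _ le)|/ltnW le /(_ _ _ le) h /esym /h].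
move=> /eqP; rewrite eq_sym -subr_eq0 -mulrBl -natrB //.
have [/eqP|k] := posnP (j - i).
  by rewrite subn_eq0 => ji _; apply/eqP; rewrite eqn_leq ij.
by rewrite -(prednK k) (negPf (c0 _)).
Qed.

End PolyDeriv.

(** * The equations in [C[t]] *)

Section BlockData.
Context (K : numFieldType).
Implicit Types (q x c : K) (m n : int) (i j : nat) (g D : {poly K}).
Implicit Types (w A B : int -> nat -> {poly K}) (b e f u : int -> {poly K}).

Definition bcoef q m i n j : {poly K} :=
  n%:~R * (i%:R + q%:P) - m%:~R * (j%:R + q%:P).

Definition bcocycle m i n j : K :=
  (m ^+ 3 - m)%:~R / 12%:R * ((i + j == 0)%N && (m + n == 0))%:R.

(* With [w m i = W_{m,i} 1] and [L_{m,i} 1 = s * A m i + B m i], these are the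
   relation [[L, W]] and the part of [[L, L]] free of [s], both applied to [1]. *)
Record block_data q w A B (c1 c2 : K) : Prop := BlockData {
  bd_w0 : w 0 0 = 'X;
  bd_A0 : A 0 0 = 1;
  bd_B0 : B 0 0 = 0;
  bd_LW m i n j :
    n%:~R * q%:P * w n j * A m i - m%:~R * q%:P * w m i * (w n j)^`()
    = bcoef q m i n j * w (m + n) (i + j)%N + (bcocycle m i n j * c2)%:P;
  bd_LL m i n j :
    - m%:~R * q%:P * A n j * B m i
    - m%:~R * q%:P * w m i * ((B n j)^`() - m%:~R * q%:P * (A n j)^`())
    + n%:~R * q%:P * A m i * B n j
    + n%:~R * q%:P * w n j * ((B m i)^`() - n%:~R * q%:P * (A m i)^`())
    = bcoef q m i n j * B (m + n) (i + j)%N + (bcocycle m i n j * c1)%:P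
}.

Lemma twist_block_data q w A B (c1 c2 : K) lam : lam != 0 ->
  block_data q w A B c1 c2 ->
  let tw v m i := (lam ^ (- m))%:P * v m i in
  block_data q (tw w) (tw A) (tw B) c1 c2.
Proof.
move=> lam0 [hw hA hB hLW hLL] tw.
have twM m n : (lam ^ (- (m + n)))%:P
    = (lam ^ (- m))%:P * (lam ^ (- n))%:P :> {poly K}.
  by rewrite opprD expfzDr // polyCM.
have twc m i n j c : (bcocycle m i n j * c)%:P
    = (lam ^ (- m))%:P * (lam ^ (- n))%:P * (bcocycle m i n j * c)%:P.
  rewrite -twM /bcocycle; have [->|_] := eqVneq (m + n) 0.
    by rewrite oppr0 expr0z mul1r.
  by rewrite andbF mulr0 mul0r mulr0.
split; rewrite /tw ?oppr0 ?expr0z ?mul1r //.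
- move=> m i n j; rewrite deriv_mulC twM (twc m i n j).
  apply: (lincomb1 (c := (lam ^ (- m))%:P * (lam ^ (- n))%:P) (hLW m i n j)).
  by ring.
- move=> m i n j; rewrite !deriv_mulC twM (twc m i n j).
  apply: (lincomb1 (c := (lam ^ (- m))%:P * (lam ^ (- n))%:P) (hLL m i n j)).
  by ring.
Qed.

(** The relation steps from [m] to [m + n] with factor [n - m], which is zero exactly at the steps
    from 1 to 2 and from -1 to -2. So [e 2] and [e (-2)] are first killed by the Euler equations of
    the pairs [(2, -1)] and [(-2, 1)]; induction does the rest. *)
Lemma level0_unique x e : e 1 = 0 -> e (-1) = 0 ->
  (forall m n, n = 1 \/ n = -1 ->
    n%:~R * ('X - n%:~R * x%:P) * (e m)^`() - m%:~R * e m
    = (n - m)%:~R * e (m + n)) ->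
  forall m, m != 0 -> e m = 0.
Proof.
move=> e1 eN1 h.
have e2 : e 2 = 0.
  apply: (@euler_inj _ 1 (- x)).
  have := h 2 (-1) (or_intror erefl); rewrite (_ : 2 - 1 = 1) // e1 => hh.
  by apply: (lincomb1 (c := -1) hh); rewrite polyCN; ring.
have eN2 : e (-2) = 0.
  apply: (@euler_inj _ 1 x).
  have := h (-2) 1 (or_introl erefl); rewrite (_ : -2 + 1 = -1) // eN1 => hh.
  by apply: (lincomb1 (c := 1) hh); ring.
have step (k : nat) : e k.+2 = 0 /\ e (- k.+2%:Z) = 0.
  elim: k => [//|k [IH1 IH2]]; split.
    have := h k.+2 1 (or_introl erefl).
    rewrite IH1 linear0 !mulr0 subrr (_ : k.+2%:Z + 1 = k.+3); last first.
      by rewrite -PoszD addn1.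
    move=> /esym/eqP; rewrite mulf_eq0 poly_intr_eq0 => /orP[|/eqP //].
    by rewrite subr_eq0.
  have := h (- k.+2%:Z) (-1) (or_intror erefl).
  rewrite IH2 linear0 !mulr0 subrr (_ : - k.+2%:Z - 1 = - k.+3%:Z); last first.
    by rewrite -opprD -PoszD addn1.
  move=> /esym/eqP; rewrite mulf_eq0 poly_intr_eq0 => /orP[|/eqP //].
  by rewrite opprK addrC subr_eq0.
case=> [[|[|k]]|[|k]] // _; first by case: (step k).
by rewrite NegzE; case: (step k).
Qed.

Lemma block_data_LW0 q w A B (c1 c2 : K) m n : q != 0 ->
  block_data q w A B c1 c2 -> m + n != 0 \/ m ^+ 3 = m ->
  n%:~R * w n 0%N * A m 0%N - m%:~R * w m 0%N * (w n 0%N)^`()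
  = (n - m)%:~R * w (m + n) 0%N.
Proof.
move=> q0 [_ _ _ hLW _] h; have qP : q%:P != 0 by rewrite polyC_eq0.
have := hLW m 0%N n 0%N; rewrite (_ : bcocycle m 0 n 0 = 0); last first.
  rewrite /bcocycle; case: h => [/negPf->|->]; first by rewrite andbF mulr0.
  by rewrite subrr !mul0r.
rewrite mul0r addr0 ?addn0 /bcoef => hh; apply: (mulfI qP).
by apply: (lincomb1 (c := 1) hh); ring.
Qed.

(** If [w m 0] vanished, so would the left side of [bd_LW] for [(- m, m)], whereas the coefficient
    of ['X] on the right is [2 m q]. Reading this coefficient discards the central constant. *)
Lemma block_data_w_neq0 q w A B (c1 c2 : K) m : q != 0 -> m != 0 ->
  block_data q w A B c1 c2 -> w m 0%N != 0.
Proof.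
move=> q0 m0 [hw _ _ hLW _]; apply/negP => /eqP wm.
have := hLW (- m) 0%N m 0%N; rewrite wm linear0 addNr hw ?addn0 /bcoef.
move=> /(congr1 (fun p : {poly K} => p`_1)).
rewrite !(mulr0, mul0r) subrr coef0 => /esym.
rewrite (_ : _ * _ - _ = (2 * m%:~R * q)%:P); last by ring.
rewrite coefD coefCM coefC coefX addr0 mulr1 => /eqP.
by rewrite !mulf_eq0 intr_eq0 (negPf m0) (negPf q0) pnatr_eq0.
Qed.

(** The pair [(m, m)] has right side zero, and the factor [m * w m 0] can be cancelled on the
    left. *)
Lemma block_data_A q w A B (c1 c2 : K) m : q != 0 -> m != 0 ->
  block_data q w A B c1 c2 -> A m 0%N = (w m 0%N)^`().
Proof.
move=> q0 m0 bd; have w0 := block_data_w_neq0 q0 m0 bd.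
have := block_data_LW0 (m := m) (n := m) q0 bd; rewrite subrr mul0r => hh.
have mP : m%:~R * w m 0%N != 0 by rewrite mulf_neq0 // poly_intr_eq0.
apply: (mulfI mP); apply: (lincomb1 (c := 1) (hh _)); last by ring.
by left; rewrite -mulr2n mulrn_eq0.
Qed.

(** Once [A m 0] is the derivative of [w m 0], the pair [(1, -1)] integrates to
    [w 1 0 * w (-1) 0 = 'X^2 + k]. Both factors turn out to be linear, and comparing coefficients
    makes their leading coefficients inverse and their roots opposite. *)
Lemma lead_data q w A B (c1 c2 : K) : q != 0 -> block_data q w A B c1 c2 ->
  exists lam x, [/\ lam != 0, w 1 0%N = lam%:P * ('X - x%:P)
    & w (-1) 0%N = lam^-1%:P * ('X + x%:P)].
Proof.
move=> q0 bd; pose v m := w m 0%N.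
have v0 m : m != 0 -> v m != 0 by move=> m0; exact: block_data_w_neq0 bd.
have hW m n : m != 0 -> m + n != 0 \/ m ^+ 3 = m ->
    n%:~R * v n * (v m)^`() - m%:~R * v m * (v n)^`() = (n - m)%:~R * v (m + n).
  by move=> m0; rewrite -(block_data_A q0 m0 bd); exact: block_data_LW0 bd.
have W1 : v 1 * v (-1) = 'X^2 + ((v 1 * v (-1) - 'X^2)`_0)%:P.
  rewrite -deriv_eq0; first by rewrite addrC subrK.
  rewrite derivB derivM derivXn expr1.
  have := hW 1 (-1) isT (or_intror erefl); rewrite subrr /v (bd_w0 bd) => hh.
  by apply: (lincomb1 (c := -1) hh); ring.
move: (_`_0) W1 => k W1.
have sz (e : int) : e = 1 \/ e = -1 -> (size (v (- e)) <= 2)%N.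
  move=> he; have e0 : e != 0 by case: he => ->.
  have WE : v e * v (- e) = 'X^2 + k%:P.
    by case: he => -> //; rewrite opprK mulrC.
  (* By the pair [(2e, -e)] the derivative of [F] is [3 * v e * v (- e)], so [F] is a cubic; as
     [v (- e)] enters squared, its degree is at most one. *)
  pose F := v (2 * e) * v (- e) ^+ 2.
  have FE : F = 'X^3 + (3 * k)%:P * 'X + ((F - 'X^3 - (3 * k)%:P * 'X)`_0)%:P.
    rewrite -deriv_eq0; first by ring.
    rewrite !derivB derivXn deriv_mulC derivX /F derivM derivCE /=.
    have := hW (2 * e) (- e); rewrite (_ : 2 * e - e = e); last by ring.
    move=> /(_ _ (or_introl e0)) hh.
    have {}hh : v (- e) * (v (2 * e))^`() + 2 * v (2 * e) * (v (- e))^`() = 3 * v e.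
      have eP : (e%:~R : {poly K}) != 0 by rewrite poly_intr_eq0.
      apply: (mulfI eP); apply: (lincomb1 (c := -1) (hh _)); last by ring.
      by rewrite mulf_neq0.
    apply: (lincomb2 (c := v (- e)) (d := 3) hh WE); ring.
  have : size F = 4%N.
    rewrite FE -addrA size_polyDl ?size_polyXn //.
    apply: leq_ltn_trans (size_polyD _ _) _; rewrite gtn_max.
    rewrite (leq_ltn_trans (size_polyC_leq1 _)) // andbT.
    rewrite (leq_ltn_trans (size_polyMleq _ _)) // size_polyX size_polyC.
    by case: (_ == 0).
  have ve := v0 (- e); rewrite oppr_eq0 in ve; have {}ve := ve e0.
  have v2 : v (2 * e) != 0 by apply: v0; rewrite mulf_neq0.
  rewrite /F expr2 !size_mul ?mulf_neq0 //.
  move: ve v2; rewrite -!size_poly_gt0.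
  by move: (size (v (- e))) (size (v (2 * e))) => a b; lia.
have s1 := sz (-1) (or_intror erefl); rewrite opprK in s1.
have s2 := sz 1 (or_introl erefl).
have lin (p : {poly K}) : (size p <= 2)%N -> p = (p`_1)%:P * 'X + (p`_0)%:P.
  move=> sp; apply/polyP => i; rewrite coefD coefCM coefX coefC.
  case: i => [|[|i]]; rewrite ?(mulr0, mulr1, add0r, addr0) //.
  by rewrite nth_default // (leq_trans sp).
move: W1; rewrite -/(v 1) -/(v (-1)) (lin _ s1) (lin _ s2).
set a := (v 1)`_1; set a' := (v 1)`_0; set d := (v (-1))`_1; set d' := (v (-1))`_0.
move=> W1.
have prodE : (a%:P * 'X + a'%:P) * (d%:P * 'X + d'%:P)
    = (a * d)%:P * 'X^2 + (a * d' + a' * d)%:P * 'X + (a' * d')%:P.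
  by ring.
rewrite prodE in W1.
have e1 : a * d = 1.
  have := congr1 (fun p : {poly K} => p`_2) W1.
  by rewrite !coefD !coefCM coefXn coefX !coefC /= !mulr0 !addr0 mulr1.
have e2 : a * d' + a' * d = 0.
  have := congr1 (fun p : {poly K} => p`_1) W1.
  by rewrite !coefD !coefCM coefXn coefX !coefC /= !mulr0 !addr0 add0r mulr1.
have a0 : a != 0 by apply/eqP => a0; move/eqP: e1; rewrite a0 mul0r eq_sym oner_eq0.
have dE : d = a^-1 by apply: (mulfI a0); rewrite e1 divff.
exists a, (- a' / a); clearbody a a' d d'; split=> //.
  rewrite mulrBr; congr (_ + _); rewrite -polyCM -polyCN; congr _%:P.
  by field.
rewrite mulrDr -polyCM dE; congr (_ + _%:P).
by apply: (mulfI a0); apply: (lincomb1 (c := 1) e2); rewrite dE; field.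
Qed.

End BlockData.

(** * Level zero *)

Section Level0.
Context (K : numFieldType) (q x : K) (w A B : int -> nat -> {poly K}).
Context (c1 c2 : K).
Context (q0 : q != 0) (bd : block_data q w A B c1 c2).
Context (w1 : w 1 0%N = 'X - x%:P) (wN1 : w (-1) 0%N = 'X + x%:P).
Implicit Types (m n : int).

Lemma level0_w m : w m 0%N = 'X - m%:~R * x%:P.
Proof.
have [->|m0] := eqVneq m 0; first by rewrite (bd_w0 bd); ring.
pose e m := w m 0%N - ('X - m%:~R * x%:P).
have e1 : e 1 = 0 by rewrite /e w1; ring.
have eN1 : e (-1) = 0 by rewrite /e wN1; ring.
apply/eqP; rewrite -subr_eq0; apply/eqP.
apply: (@level0_unique _ x e e1 eN1 _ m m0) => {m m0} m n hn.
have [->|m0] := eqVneq m 0.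
  have -> : e 0 = 0 by rewrite /e (bd_w0 bd); ring.
  rewrite linear0 add0r subr0.
  by case: hn => ->; rewrite ?e1 ?eN1; ring.
(* If [m + n = 0] then [m] is 1 or -1, where the factor [m ^+ 3 - m] of the cocycle vanishes. *)
have hmn : m + n != 0 \/ m ^+ 3 = m.
  have [h|] := eqVneq (m + n) 0; last by left.
  by right; move/eqP: h; rewrite addr_eq0 => /eqP ->; case: hn => ->.
have := block_data_LW0 (m := m) (n := n) q0 bd hmn.
rewrite (block_data_A q0 m0 bd) /e !derivE ?deriv_intr.
have -> : w n 0%N = 'X - n%:~R * x%:P.
  by case: hn => ->; rewrite ?w1 ?wN1; ring.
rewrite !derivE ?deriv_intr => h.
by apply: (lincomb1 (c := 1) h); ring.
Qed.

Lemma level0_A m : A m 0%N = 1.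
Proof.
have [->|m0] := eqVneq m 0; first exact: bd_A0 bd.
rewrite (block_data_A q0 m0 bd) level0_w !derivE ?deriv_intr; ring.
Qed.

(** The cocycle vanishes for [m = 0, 1, -1], so [(2, -2)] is the first pair that detects the central
    constants [c1] and [c2]. *)
Lemma bcocycle2 : 2 * bcocycle K 2 0 (-2) 0 = 1.
Proof. by rewrite /bcocycle /= mulr1 (_ : 2 ^+ 3 - 2 = 6) //; field. Qed.

Lemma level0_c2 : c2 = 0.
Proof.
have := bd_LW bd 2 0%N (-2) 0%N.
rewrite !level0_A !level0_w subrr.
rewrite !derivE ?deriv_intr /bcoef => h; apply: polyC_inj.
apply: (lincomb2 (c := -2) (d := - c2%:P) h (congr1 polyC bcocycle2)).
by rewrite !polyCM; ring.
Qed.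

Context (D : {poly K}).
Let g := B 1 0%N.
Context (gD : g - g.[x]%:P = D * ('X - x%:P)).

Lemma level0_LL m n : m + n != 0 \/ m ^+ 3 = m ->
  n%:~R * B n 0%N - m%:~R * B m 0%N
  - m%:~R * ('X - m%:~R * x%:P) * (B n 0%N)^`()
  + n%:~R * ('X - n%:~R * x%:P) * (B m 0%N)^`()
  = (n - m)%:~R * B (m + n) 0%N.
Proof.
move=> h; have qP : q%:P != 0 by rewrite polyC_eq0.
have := bd_LL bd m 0%N n 0%N; rewrite (_ : bcocycle K m 0 n 0 = 0); last first.
  rewrite /bcocycle; case: h => [/negPf->|->]; first by rewrite andbF mulr0.
  by rewrite subrr !mul0r.
rewrite !level0_A !level0_w -polyC1 !derivC /bcoef => hh.
apply: (mulfI qP); apply: (lincomb1 (c := 1) hh); ring.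
Qed.

Lemma level0_deriv : g^`() = D + ('X - x%:P) * D^`().
Proof.
have := congr1 (@deriv K) gD; rewrite !derivE subr0 => ->; ring.
Qed.

(** [D] is the divided difference of [g] at [x], as in [hpoly]. The right side agrees with [B] at 1
    by the choice of [g] and at -1 by an Euler equation, and their difference obeys the relation of
    [level0_unique]. *)
Lemma level0_B m : B m 0%N = m%:~R * g - m%:~R * (m - 1)%:~R * x%:P * D.
Proof.
have dg := level0_deriv.
have [->|m0] := eqVneq m 0; first by rewrite (bd_B0 bd); ring.
pose f m := m%:~R * g - m%:~R * (m - 1)%:~R * x%:P * D.
pose e m := B m 0%N - f m.
have df k : (f k)^`() = k%:~R * (D + ('X - x%:P) * D^`())
   - k%:~R * (k - 1)%:~R * x%:P * D^`().
  rewrite /f derivB !derivM !deriv_intr derivC dg; ring.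
have e1 : e 1 = 0 by rewrite /e /f -/g; ring.
have eN1 : e (-1) = 0.
  apply: (@euler_inj _ 0 x).
  have := level0_LL (m := -1) (n := 1) (or_intror erefl).
  rewrite (bd_B0 bd) -/g dg /e derivB df /f => h.
  by apply: (lincomb1 (c := 1) h); ring.
apply/eqP; rewrite -subr_eq0; apply/eqP.
apply: (@level0_unique _ x e e1 eN1 _ m m0) => {m m0} m n hn.
have hmn : m + n != 0 \/ m ^+ 3 = m.
  have [h|] := eqVneq (m + n) 0; last by left.
  by right; move/eqP: h; rewrite addr_eq0 => /eqP ->; case: hn => ->.
have := level0_LL hmn.
have -> : B n 0%N = f n.
  by apply/eqP; rewrite -subr_eq0 -/(e n); case: hn => ->; rewrite ?e1 ?eN1.
rewrite /e (derivB (B m 0%N) (f m)) !df /f => h.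
by apply: (lincomb1 (c := 1) h); ring.
Qed.

Lemma level0_c1 : c1 = 0.
Proof.
have dg := level0_deriv.
have := bd_LL bd 2 0%N (-2) 0%N.
rewrite !level0_A !level0_w subrr (bd_B0 bd) !level0_B.
rewrite !derivE ?deriv_intr dg /bcoef => h; apply: polyC_inj.
apply: (lincomb2 (c := -2) (d := - c1%:P) h (congr1 polyC bcocycle2)).
by rewrite !polyCM; ring.
Qed.

End Level0.

(** * Positive levels *)

Section Homogeneous.
Context (K : numFieldType) (q x : K) (i : nat) (f : int -> {poly K}).
Context (q0 : q != 0) (i0 : (0 < i)%N).
Context (fE : forall m n : int,
  n%:~R * q%:P * f n - m%:~R * q%:P * ('X - m%:~R * x%:P) * (f n)^`()
  = (n%:~R * q%:P - m%:~R * (i%:R + q%:P)) * f (m + n)).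
Implicit Types m n : int.

(** The pair [(m, 0)] determines [f m] from the derivative of [f 0] if [i + q] is nonzero, and
    forces [f 0] to be constant otherwise. *)
Lemma homog_shift m : m != 0 ->
  (i%:R + q)%:P * f m = q%:P * ('X - m%:~R * x%:P) * (f 0)^`().
Proof.
move=> m0; have mP : (m%:~R : {poly K}) != 0 by rewrite poly_intr_eq0.
apply: (mulfI mP); have := fE m 0; rewrite addr0 => h.
by apply: (lincomb1 (c := 1) h); ring.
Qed.

Lemma homog_opp n : n != 0 ->
  q%:P * (f n + ('X + n%:~R * x%:P) * (f n)^`()) = (i%:R + 2 * q)%:P * f 0.
Proof.
move=> n0; have nP : (n%:~R : {poly K}) != 0 by rewrite poly_intr_eq0.
apply: (mulfI nP); have := fE (- n) n; rewrite addNr => h.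
by apply: (lincomb1 (c := 1) h); ring.
Qed.

Lemma homog_const c : f 0 = c%:P -> i%:R + q != 0 ->
  (i%:R + 2 * q) * c = 0 /\ forall m, m != 0 -> f m = 0.
Proof.
move=> f0 iq; have fm m : m != 0 -> f m = 0.
  move=> /homog_shift /eqP; rewrite f0 derivC mulr0 mulf_eq0 polyC_eq0 (negPf iq).
  by move/eqP.
split=> //; have := homog_opp (n := 1) isT.
rewrite fm // linear0 mulr0 add0r mulr0 f0 -polyCM => /esym/eqP.
by rewrite polyC_eq0 => /eqP.
Qed.

(** By [homog_shift], [f 0] is constant. As [i + 2q = q], [homog_opp] is then the Euler equation for
    [f m - f 0]. *)
Lemma homogeneous_neg : i%:R + q = 0 -> exists c, forall m, f m = c%:P.
Proof.
move=> iq; exists (f 0)`_0 => m.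
have f0 : f 0 = ((f 0)`_0)%:P.
  apply: deriv_eq0; have := homog_shift (m := 1) isT.
  rewrite iq mul0r => /esym/eqP; rewrite !mulf_eq0 polyC_eq0 (negPf q0) /=.
  by rewrite mul1r polyXsubC_eq0 /= => /eqP.
have [-> //|m0] := eqVneq m 0; rewrite -f0.
apply/eqP; rewrite -subr_eq0; apply/eqP; apply: (@euler_inj _ 0 (- (m%:~R * x))).
have qP : q%:P != 0 by rewrite polyC_eq0.
apply: (mulfI qP); rewrite polyCN opprK polyCM derivB {2}f0 derivC.
by apply: (lincomb2 (c := 1) (d := f 0) (homog_opp m0) (congr1 polyC iq)); ring.
Qed.

(** If [f 0] is not constant, the pairs [(1, 1)] and [(1, 2)] give two first-order equations for its
    derivative [d], compatible only for [x = 0]. There remains [q 'X d' = i d], solved by monomials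
    of degree [i / q]. *)
Lemma homogeneous_pos : i%:R + q != 0 ->
  (exists c, [/\ f 0 = c%:P, (i%:R + 2 * q) * c = 0
     & forall m, m != 0 -> f m = 0])
  \/ x = 0 /\ exists r : nat, i%:R = r.+1%:R * q /\
     exists c, forall m, f m = c%:P * 'X^(r.+2).
Proof.
move=> iq; have [df0|df0] := eqVneq (f 0)^`() 0.
  by left; exists (f 0)`_0; have h := deriv_eq0 df0; have [] := homog_const h iq.
right; have iqP : (i%:R + q)%:P != 0 by rewrite polyC_eq0.
have qP : q%:P != 0 by rewrite polyC_eq0.
have iP : (i%:R : {poly K}) != 0.
  by rewrite -(rmorph_nat (@polyC K)) polyC_eq0 pnatr_eq0 -lt0n.
pose k := (q / (i%:R + q))%:P; pose d := (f 0)^`().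
have d0 : d != 0 := df0.
have k0 : k != 0 by rewrite polyC_eq0 mulf_neq0 // invr_eq0.
have fk m : m != 0 -> f m = k * ('X - m%:~R * x%:P) * d.
  have kE : (i%:R + q)%:P * k = q%:P by rewrite -polyCM; congr _%:P; field.
  move=> /homog_shift h; apply: (mulfI iqP).
  by apply: (lincomb2 (c := 1) (d := - ('X - m%:~R * x%:P) * d) h kE); ring.
have dk m : m != 0 -> (f m)^`() = k * d + k * ('X - m%:~R * x%:P) * d^`().
  by move=> m0; rewrite fk // !derivE ?deriv_intr; ring.
have e1 : q%:P * ('X - x%:P) ^+ 2 * d^`() = i%:R * ('X - 2 * x%:P) * d.
  apply: (mulfI k0); have := fE 1 1; rewrite dk // !fk // => h.
  by apply: (lincomb1 (c := -1) h); ring.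
have e2 : q%:P * ('X - x%:P) * ('X - 2 * x%:P) * d^`() = i%:R * ('X - 3 * x%:P) * d.
  apply: (mulfI k0); have := fE 1 2; rewrite dk // !fk // => h.
  by apply: (lincomb1 (c := -1) h); ring.
(* Eliminating the derivative of [d] between [e1] and [e2] leaves [i d x^2 = 0]. *)
have x0 : x = 0.
  have /eqP : i%:R * d * x%:P ^+ 2 = 0.
    by apply: (lincomb2 (c := -('X - 2 * x%:P)) (d := 'X - x%:P) e1 e2); ring.
  by rewrite !mulf_eq0 (negPf d0) (negPf iP) polyC_eq0 /= orbb => /eqP.
split=> //.
have e3 : q%:P * 'X * d^`() = i%:R * d.
  by apply: (mulfI (negbT (polyX_eq0 K))); move: e1; rewrite x0 => h;
    apply: (lincomb1 (c := 1) h); ring.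
have dE j : i%:R * d`_j = j%:R * q * d`_j.
  have := congr1 (fun p : {poly K} => p`_j) e3.
  rewrite -mulrA coefCM -(rmorph_nat (@polyC K)) coefCM => <-.
  rewrite coefXM; case: j => [|j]; first by rewrite eqxx mulr0 !mul0r.
  by rewrite coef_deriv /= -mulr_natl; ring.
have lead0 : d`_(size d).-1 != 0 by rewrite -lead_coefE lead_coef_eq0.
have iE : i%:R = (size d).-1%:R * q by apply: (mulIf lead0); rewrite dE.
(* A constant [d] would give [i = 0], so the degree of [d] is some [r.+1]. *)
case sd : (size d).-1 iE lead0 => [|r] iE lead0.
  by move/eqP: iE; rewrite mul0r pnatr_eq0 -leqn0 leqNgt i0.
exists r; split=> //; exists (q / (i%:R + q) * d`_r.+1).
have dX : d = (d`_r.+1)%:P * 'X^(r.+1).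
  apply/polyP => j; rewrite coefCM coefXn; have [->|jr] := eqVneq j r.+1.
    by rewrite mulr1.
  rewrite mulr0; have /eqP := dE j; rewrite iE -subr_eq0 -mulrBl -mulrBl.
  rewrite !mulf_eq0 (negPf q0) orbF subr_eq0 eqr_nat eq_sym (negPf jr) /=.
  by move/eqP.
have f0E : f 0 = k * 'X * d.
  have iq2P : (i%:R + 2 * q)%:P != 0.
    by rewrite polyC_eq0 iE -mulrDl -natrD mulf_neq0 // pnatr_eq0 addnS.
  apply: (mulfI iq2P); rewrite -(homog_opp (n := 1)) // dk // fk // x0.
  by apply: (lincomb1 (c := k * 'X) e3); ring.
move=> m; have -> : f m = k * 'X * d.
  by have [->|m0] := eqVneq m 0; rewrite // fk // x0; ring.
by rewrite {1}dX polyCM -/k !exprS; ring.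
Qed.

End Homogeneous.

(** * Normal forms of a single positive level *)

Section HigherLevel.
Context (K : numFieldType) (q x : K) (w A B : int -> nat -> {poly K}).
Context (c1 c2 : K) (g D : {poly K}) (i : nat).
Context (q0 : q != 0) (bd : block_data q w A B c1 c2) (i0 : (0 < i)%N).
Context (w0 : forall m, w m 0%N = 'X - m%:~R * x%:P).
Context (A0 : forall m, A m 0%N = 1).
Context (B0 : forall m, B m 0%N = m%:~R * g - m%:~R * (m - 1)%:~R * x%:P * D).
Context (dg : g^`() = D + ('X - x%:P) * D^`()).
Implicit Types m n : int.

Lemma level_w m n :
  n%:~R * q%:P * w n i - m%:~R * q%:P * ('X - m%:~R * x%:P) * (w n i)^`()
  = (n%:~R * q%:P - m%:~R * (i%:R + q%:P)) * w (m + n) i.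
Proof.
have := bd_LW bd m 0%N n i; rewrite /bcocycle addn_eq0 (gtn_eqF i0) /= add0n.
rewrite mulr0 mul0r A0 w0 /bcoef => h.
by apply: (lincomb1 (c := 1) h); ring.
Qed.

Lemma level_A m n :
  n%:~R * q%:P * ('X - n%:~R * x%:P) * A m i - m%:~R * q%:P * w m i
  = (n%:~R * (i%:R + q%:P) - m%:~R * q%:P) * w (m + n) i.
Proof.
have := bd_LW bd m i n 0%N; rewrite /bcocycle addn_eq0 (gtn_eqF i0) /= addn0.
rewrite mulr0 mul0r w0 !derivE ?deriv_intr /bcoef => h.
by apply: (lincomb1 (c := 1) h); ring.
Qed.

Lemma level_B m n :
  - m%:~R * q%:P * A n i * B m 0%N
  - m%:~R * q%:P * ('X - m%:~R * x%:P)
    * ((B n i)^`() - m%:~R * q%:P * (A n i)^`())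
  + n%:~R * q%:P * B n i + n%:~R * q%:P * w n i * (B m 0%N)^`()
  = (n%:~R * q%:P - m%:~R * (i%:R + q%:P)) * B (m + n) i.
Proof.
have := bd_LL bd m 0%N n i; rewrite /bcocycle addn_eq0 (gtn_eqF i0) /= add0n.
rewrite mulr0 mul0r A0 w0 -polyC1 derivC /bcoef => h.
by apply: (lincomb1 (c := 1) h); ring.
Qed.

Lemma level_B0_deriv m :
  (B m 0%N)^`() = m%:~R * g^`() - m%:~R * (m - 1)%:~R * x%:P * D^`().
Proof. by rewrite B0 derivB !derivM !deriv_intr derivC; ring. Qed.

Lemma level_neg : i%:R + q = 0 -> exists c d,
  forall m, [/\ w m i = c%:P, A m i = 0 & B m i = d%:P + m%:~R * c%:P * D].
Proof.
move=> iq; have [c wE] := homogeneous_neg q0 level_w iq.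
have qP : q%:P != 0 by rewrite polyC_eq0.
have iqP := congr1 (@polyC K) iq.
have AE m : A m i = 0.
  have : q%:P * ('X - x%:P) * A m i = 0.
    by have := level_A m 1; rewrite !wE => h;
      apply: (lincomb2 (c := 1) (d := c%:P) h iqP); ring.
  by move/eqP; rewrite !mulf_eq0 (negPf qP) polyXsubC_eq0 => /eqP.
pose e m := B m i - m%:~R * c%:P * D.
have [d eE] : exists d, forall m, e m = d%:P.
  apply: (homogeneous_neg (x := x) q0 _ iq) => m n; have := level_B m n.
  rewrite level_B0_deriv !wE !AE linear0 dg => h.
  rewrite /e derivB !derivM deriv_intr derivC.
  by apply: (lincomb2 (c := 1) (d := - m%:~R * (m + n)%:~R * c%:P * D) h iqP); ring.
exists c, d => m; split=> //.
by rewrite -(eE m) /e; ring.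
Qed.

(** The homogeneous equation is solved for [w], then for [B] minus a particular solution. A monomial
    [B] with vanishing [w] falls under the second alternative with [a = 0]; there [i + 2q] is a
    nonzero multiple of [q], which excludes central constants. *)
Lemma level_pos : i%:R + q != 0 ->
  (exists c d, [/\ (i%:R + 2 * q) * c = 0, (i%:R + 2 * q) * d = 0
    & forall m, [/\ w m i = ((m == 0)%:R * c)%:P, A m i = 0
      & B m i = ((m == 0)%:R * d)%:P]])
  \/ [/\ x = 0 & exists2 r : nat, i%:R = r.+1%:R * q &
     exists a b, forall m, [/\ w m i = a%:P * 'X^(r.+2),
       A m i = r.+2%:R * a%:P * 'X^(r.+1)
       & B m i = m%:~R * a%:P * 'X^(r.+1) * (g - i%:R) + b%:P * 'X^(r.+2)]].
Proof.
move=> iq; have qP : q%:P != 0 by rewrite polyC_eq0.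
have pos r : i%:R = r.+1%:R * q -> i%:R + 2 * q != 0.
  by move=> ->; rewrite -mulrDl -natrD mulf_neq0 // pnatr_eq0 addnS.
case: (homogeneous_pos q0 i0 level_w iq) => [[c [wc iqc wE]]|[x0 [r [ir [a wE]]]]].
  have AE m : A m i = 0.
    have [->|m0] := eqVneq m 0.
      have := level_A 0 1; rewrite (wE (0 + 1)) // => h.
      have /eqP : q%:P * ('X - x%:P) * A 0 i = 0.
        by apply: (lincomb1 (c := 1) h); ring.
      by rewrite !mulf_eq0 (negPf qP) polyXsubC_eq0 => /eqP.
    have := level_A m m; rewrite wE // (wE (m + m)) => [h|]; last first.
      by rewrite -mulr2n mulrn_eq0.
    have /eqP : m%:~R * q%:P * ('X - (m%:~R * x)%:P) * A m i = 0.
      by apply: (lincomb1 (c := 1) h); ring.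
    by rewrite !mulf_eq0 (negPf qP) poly_intr_eq0 (negPf m0) polyXsubC_eq0 => /eqP.
  have BE m n : n%:~R * q%:P * B n i
        - m%:~R * q%:P * ('X - m%:~R * x%:P) * (B n i)^`()
      = (n%:~R * q%:P - m%:~R * (i%:R + q%:P)) * B (m + n) i.
    have nw : n%:~R * w n i = 0.
      by have [->|n0] := eqVneq n 0; rewrite ?mul0r // wE // mulr0.
    have := level_B m n; rewrite AE linear0 => h.
    by apply: (lincomb2 (c := 1) (d := - q%:P * (B m 0%N)^`()) h nw); ring.
  case: (homogeneous_pos q0 i0 BE iq) => [[d [Bd iqd Bm]]|[x0 [r [ir [b Bm]]]]].
    left; exists c, d; split=> // m; rewrite AE.
    have [->|m0] := eqVneq m 0; first by rewrite wc Bd !mul1r.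
    by rewrite wE // Bm // !mul0r polyC0.
  right; split=> //; exists r => //; exists 0, b => m.
  have c0 : c = 0 by move/eqP: iqc; rewrite mulf_eq0 (negPf (pos r ir)) => /eqP.
  rewrite Bm AE polyC0 !(mulr0, mul0r, add0r); split=> //.
  by have [->|m0] := eqVneq m 0; rewrite ?wc ?c0 ?polyC0 // wE.
right; split=> //; exists r => //.
have irP : i%:R = r.+1%:R * q%:P :> {poly K}.
  by apply: (lincomb1 (c := 1) (congr1 (@polyC K) ir)); ring.
have AE m : A m i = r.+2%:R * a%:P * 'X^(r.+1).
  have XP : q%:P * 'X != 0 by rewrite mulf_neq0 // polyX_eq0.
  apply: (mulfI XP); have [->|m0] := eqVneq m 0.
    have := level_A 0 1; rewrite !wE x0 irP => h.
    by apply: (lincomb1 (c := 1) h); rewrite !exprS; ring.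
  have mP : (m%:~R : {poly K}) != 0 by rewrite poly_intr_eq0.
  apply: (mulfI mP); have := level_A m (- m); rewrite !wE x0 irP => h.
  by apply: (lincomb1 (c := -1) h); rewrite !exprS; ring.
pose e m := B m i - m%:~R * a%:P * 'X^(r.+1) * (g - i%:R).
have eE m n : n%:~R * q%:P * e n - m%:~R * q%:P * ('X - m%:~R * x%:P) * (e n)^`()
    = (n%:~R * q%:P - m%:~R * (i%:R + q%:P)) * e (m + n).
  have := level_B m n; rewrite level_B0_deriv B0 !wE !AE !derivM dg x0.
  rewrite /e derivB !derivM derivB derivXn deriv_intr derivC !deriv_natr dg x0.
  rewrite /= irP => h.
  apply: (lincomb1 (c := 1) h); rewrite !exprS; ring.
case: (homogeneous_pos q0 i0 eE iq) => [[b [eb iqb em]]|[_ [r' [ir' [b eb]]]]].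
  have b0 : b = 0 by move/eqP: iqb; rewrite mulf_eq0 (negPf (pos r ir)) => /eqP.
  exists a, 0 => m; rewrite wE AE; split=> //; rewrite polyC0 mul0r addr0.
  apply/eqP; rewrite -subr_eq0 -/(e m).
  by have [->|m0] := eqVneq m 0; rewrite ?eb ?b0 // em.
exists a, b => m; rewrite wE AE; split=> //.
have rE : r' = r.
  have /eqP := etrans (esym ir') ir.
  by rewrite (inj_eq (mulIf q0)) eqr_nat => /eqP [].
by rewrite rE in eb; rewrite -(eb m) /e; ring.
Qed.

End HigherLevel.

(** * All positive levels together *)

Section AllLevels.
Context (K : numFieldType) (q x : K) (w A B : int -> nat -> {poly K}).
Context (c1 c2 : K) (g D : {poly K}).
Context (q0 : q != 0) (bd : block_data q w A B c1 c2).
Context (w0 : forall m, w m 0%N = 'X - m%:~R * x%:P).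
Context (A0 : forall m, A m 0%N = 1).
Context (B0 : forall m, B m 0%N = m%:~R * g - m%:~R * (m - 1)%:~R * x%:P * D).
Context (dg : g^`() = D + ('X - x%:P) * D^`()).
Implicit Types (m : int) (i : nat).

(** The two product conditions allow such a level to be nonzero only for [i = - 2q]. *)
Let central_level i := exists c d,
  [/\ (i%:R + 2 * q) * c = 0, (i%:R + 2 * q) * d = 0
    & forall m, [/\ w m i = ((m == 0)%:R * c)%:P, A m i = 0
      & B m i = ((m == 0)%:R * d)%:P]].

Let pos i (i0 : (0 < i)%N) := level_pos q0 bd i0 w0 A0 B0 dg.
Let neg i (i0 : (0 < i)%N) := level_neg q0 bd i0 w0 A0 B0 dg.

Let zero_level i : (forall m, [/\ w m i = 0, A m i = 0 & B m i = 0]) ->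
  central_level i.
Proof.
by move=> h; exists 0, 0; rewrite !mulr0; split=> // m; rewrite mulr0 polyC0.
Qed.

(* For [i >= 2], [L_{1,i}] and [W_{1,i}] are brackets of [L_{0,1}] with
   elements of level [i - 1], unless [q = -1]. *)
Lemma level1_eq0 i : 1 + q != 0 -> (1 < i)%N ->
  w 0 1%N = 0 -> A 0 1%N = 0 -> B 0 1%N = 0 -> w 1 i = 0 /\ B 1 i = 0.
Proof.
move=> q1 i1 w01 A01 B01; have qP : (1 + q)%:P != 0 by rewrite polyC_eq0.
have iE : (1 + i.-1)%N = i by rewrite add1n prednK // ltnW.
split; apply: (mulfI qP).
  have := bd_LW bd 0 1%N 1 i.-1; rewrite w01 A01 add0r iE /bcocycle iE.
  by rewrite (gtn_eqF (ltnW i1)) /= mulr0 mul0r /bcoef => h;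
    apply: (lincomb1 (c := -1) h); ring.
have := bd_LL bd 0 1%N 1 i.-1; rewrite w01 A01 B01 linear0 add0r iE /bcocycle iE.
by rewrite (gtn_eqF (ltnW i1)) /= mulr0 mul0r /bcoef => h;
  apply: (lincomb1 (c := -1) h); ring.
Qed.

(** For [q = -1] and [q = -1/2] the monomial alternative [i = r.+1 q] fails by sign. For other [q]
    level 1 vanishes, hence so do [w 1 i] and [B 1 i] by [level1_eq0], and these two values
    annihilate every noncentral normal form of level [i]. *)
Lemma central_levelP : ~ (x = 0 /\ exists n : nat, n.+1%:R * q = 1) ->
  forall i, (0 < i)%N -> ~~ ((i == 1%N) && (q == -1)) -> central_level i.
Proof.
move=> hn i i0 hi; have addn0 k l : (k%:R + l.+1%:R : K) != 0.
  by rewrite -natrD pnatr_eq0 addnS.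
have [q1|q1] := eqVneq q (-1).
  have i1 : (1 < i)%N by case: i i0 hi => [|[|i]] //; rewrite q1 !eqxx.
  have iq : i%:R + q != 0 by rewrite q1 subr_eq0 -[1]/(1%:R) eqr_nat gtn_eqF.
  case: (pos i0 iq) => // -[_ [r ir _]]; have /negP[] := addn0 i r.
  by rewrite ir q1; apply/eqP; ring.
have {}q1 : 1 + q != 0 by rewrite addrC -[1]opprK subr_eq0.
case: (pos (i := 1) isT q1) => [[c [d [qc qd h1]]]|]; last first.
  (* The monomial alternative at level 1 is exactly what [hn] excludes. *)
  by case=> x0 [r r1 _]; case: hn; split=> //; exists r; rewrite -r1.
have [i1|] := leqP i 1; first by have -> : i = 1%N; [lia | exists c, d].
move=> {}hi; have [q2|q2] := eqVneq (1 + 2 * q) 0.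
  have qE : 2 * q = -1 by apply/eqP; rewrite -subr_eq0 opprK addrC q2.
  have iq : i%:R + q != 0.
    have /negP h : (2 * i)%:R != 1%:R :> K by rewrite eqr_nat; lia.
    apply/negP => /eqP iq; apply: h; apply/eqP.
    by apply: (lincomb2 (c := 2) (d := -1) iq qE); rewrite natrM; ring.
  case: (pos i0 iq) => // -[_ [r ir _]]; have /negP[] := addn0 (2 * i)%N r.
  apply/eqP; apply: (lincomb2 (c := 2) (d := r.+1%:R) ir qE).
  by rewrite natrM; ring.
have [c0 d0] : c = 0 /\ d = 0.
  split; [move/eqP: qc | move/eqP: qd];
    by rewrite mulf_eq0 (negPf q2) => /eqP.
have [w1 b1] : w 1 i = 0 /\ B 1 i = 0.
  have [w01 A01 B01] := h1 0.
  by apply: level1_eq0 => //; rewrite ?w01 ?B01 ?c0 ?d0 mulr0 polyC0.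
have [iq|iq] := eqVneq (i%:R + q) 0.
  have [c' [d' h]] := neg i0 iq; have [] := h 1; rewrite w1 b1 => <- _.
  rewrite mulr0 mul0r addr0 => hd.
  have c'0 : c'%:P = 0 by have [<-] := h 1.
  apply: zero_level => m; have [-> -> ->] := h m.
  by rewrite -hd c'0 mulr0 mul0r addr0.
have Xn0 k (a : K) : a%:P * 'X^k = 0 :> {poly K} -> a%:P = 0 :> {poly K}.
  move/eqP; rewrite mulf_eq0 -[_ ^+ k == 0]negbK expf_neq0 ?polyX_eq0 //.
  by rewrite orbF => /eqP.
case: (pos i0 iq) => // -[_ [r _ [a [b h]]]].
have a0 : a%:P = 0 :> {poly K} by apply: (Xn0 r.+2); have [<-] := h 1.
have b0 : b%:P = 0 :> {poly K}.
  by apply: (Xn0 r.+2); have [_ _] := h 1; rewrite b1 a0 mulr0 !mul0r add0r.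
apply: zero_level => m; have [-> -> ->] := h m.
by rewrite a0 b0 !(mulr0, mul0r) addr0.
Qed.

(** Here [i + q] and [i + 2q] never vanish, so every level is of monomial type, possibly zero.
    Brackets of [L_{0,i}] with [W_{1,1}] and [L_{1,1}] express the two constants of level [i + 1]
    through those of levels [i] and 1, and induction yields [a ^+ i] and [i b a ^+ i.-1]. *)
Lemma takiff_levels n : x = 0 -> n.+1%:R * q = 1 ->
  exists a b, forall m i, (0 < i)%N ->
   [/\ w m i = (a ^+ i)%:P * 'X^(1 + i * n.+1),
       A m i = (1 + i * n.+1)%:R * (a ^+ i)%:P * 'X^(i * n.+1)
     & B m i = m%:~R * (a ^+ i)%:P * 'X^(i * n.+1) * (g - i%:R)
               + (i%:R * b * a ^+ i.-1)%:P * 'X^(1 + i * n.+1)].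
Proof.
move=> x0 nq; have qP : q%:P != 0 by rewrite polyC_eq0.
have natq k : k.+1%:R * q != 0 by rewrite mulf_neq0 // pnatr_eq0.
have iqE i : i%:R + q = (1 + i * n.+1)%:R * q.
  by apply: (lincomb1 (c := - i%:R) nq); ring.
have iqP i : i%:R + q%:P = (1 + i * n.+1)%:R * q%:P :> {poly K}.
  by apply: (lincomb1 (c := 1) (congr1 (@polyC K) (iqE i))); ring.
have lev i : (0 < i)%N -> exists a b, forall m,
   [/\ w m i = a%:P * 'X^(1 + i * n.+1),
       A m i = (1 + i * n.+1)%:R * a%:P * 'X^(i * n.+1)
     & B m i = m%:~R * a%:P * 'X^(i * n.+1) * (g - i%:R)
               + b%:P * 'X^(1 + i * n.+1)].
  move=> i0; have iq : i%:R + q != 0 by rewrite iqE add1n.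
  case: (pos i0 iq) => [[c [d [qc qd h]]]|[_ [r ir h]]].
    have i2q : i%:R + 2 * q != 0.
      have -> : i%:R + 2 * q = (2 + i * n.+1)%:R * q.
        by apply: (lincomb1 (c := - i%:R) nq); ring.
      by rewrite add2n.
    have [c0 d0] : c = 0 /\ d = 0.
      split; [move/eqP: qc | move/eqP: qd]; by rewrite mulf_eq0 (negPf i2q) => /eqP.
    exists 0, 0 => m; have [-> -> ->] := h m.
    by rewrite c0 d0 !(mulr0, mul0r, polyC0, add0r).
  have rE : (i * n.+1)%N = r.+1.
    have : (i * n.+1)%:R * q = r.+1%:R * q by rewrite natrM -mulrA nq mulr1.
    by move/(mulIf q0)/eqP; rewrite eqr_nat => /eqP.
  by rewrite rE add1n; exact: h.
have [a [b h1]] := lev 1%N isT; rewrite mul1n in h1; exists a, b.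
move=> m i; elim: i m => // -[|i] IH m _.
  have [-> -> ->] := h1 m; rewrite !mul1n expr1 expr0 !mulr1; split=> //.
  by congr (_ + _%:P * _); ring.
have [a' [b' h]] := lev i.+2 isT.
have XP k : ('X^k : {poly K}) != 0 by rewrite expf_neq0 // polyX_eq0.
have cP : ((1 + i.+1 * n.+1)%:R : {poly K}) != 0.
  by rewrite -(rmorph_nat (@polyC K)) polyC_eq0 pnatr_eq0.
have [w11 A11 B11] := h1 1; have [w0i A0i B0i] := IH 0 isT.
have [w1i A1i B1i] := h 1.
have expE : (i.+2 * n.+1 = n.+1 + i.+1 * n.+1)%N by rewrite mulSn.
set I := (i.+1 * n.+1)%N in cP w0i A0i B0i expE.
(* The powers become atoms for [ring]; their exponents enter only through [N], by way of [dY] and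
   [Nq]. *)
pose Y : {poly K} := 'X^I; pose Z : {poly K} := 'X^(n.+1).
pose N : {poly K} := I%:R.
have eN : (1 + I)%:R = 1 + N by rewrite natrD.
have dY : 'X * Y^`() = N * Y.
  by rewrite derivXn mulrnAr -exprS /N mulr_natl.
have Nq : N * q%:P = i.+1%:R.
  by apply: (lincomb1 (c := -1) (iqP i.+1)); rewrite -/I eN; ring.
have e1I : 'X^(1 + I) = 'X * Y by rewrite exprD expr1.
have e1n : 'X^(1 + n.+1) = 'X * Z :> {poly K} by rewrite exprD expr1.
have e2I : 'X^(1 + i.+2 * n.+1) = 'X * Y * Z.
  by rewrite expE !exprD expr1 -/Y -/Z; ring.
have e2I' : 'X^(i.+2 * n.+1) = Y * Z by rewrite expE exprD mulrC.
rewrite e1I eN in w0i A0i B0i; rewrite e1n in w11 B11; rewrite e2I in w1i B1i.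
rewrite e2I' in B1i; rewrite -/Y in A0i B0i; rewrite -/Z in A11 B11.
rewrite eN in cP; have YP : Y != 0 := XP I; have ZP : Z != 0 := XP n.+1.
have nz : q%:P * (1 + N) * 'X * Y * Z != 0 by rewrite !mulf_neq0 // polyX_eq0.
have iqN : i.+1%:R + q%:P = (1 + N) * q%:P by rewrite iqP eN.
have a'E : a'%:P = (a ^+ i.+2)%:P :> {poly K}.
  have := bd_LW bd 0 i.+1 1 1%N.
  rewrite add0r addn1 /bcocycle !addnS /= mulr0 mul0r.
  rewrite w11 A0i w1i /bcoef iqN => e; apply: (mulfI nz).
  by apply: (lincomb1 (c := -1) e); rewrite [a ^+ i.+2]exprS polyCM; ring.
have dN : (1 + N)^`() = 0 by rewrite -eN deriv_natr.
have dA : 'X * (A 0 i.+1)^`() = (1 + N) * (a ^+ i.+1)%:P * N * Y.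
  rewrite A0i !derivM dN derivC.
  by apply: (lincomb1 (c := (1 + N) * (a ^+ i.+1)%:P) dY); ring.
have dB : (B 0 i.+1)^`() = (i.+1%:R * b * a ^+ i)%:P * ((1 + N) * Y).
  rewrite B0i !mulr0z !mul0r add0r !derivM derivX derivC.
  rewrite [i.+1.-1]/=.
  by apply: (lincomb1 (c := (i.+1%:R * b * a ^+ i)%:P) dY); ring.
have b'E : b'%:P = (i.+2%:R * b * a ^+ i.+1)%:P :> {poly K}.
  have := bd_LL bd 0 i.+1 1 1%N.
  rewrite add0r addn1 /bcocycle !addnS /= mulr0 mul0r.
  rewrite dB w11 A0i B11 B1i a'E /bcoef iqN => e; apply: (mulfI nz).
  rewrite A0i in dA.
  apply: (lincomb3 (c := -1) (d := - q%:P ^+ 2 * a%:P * Z)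
    (e := - (q%:P * a%:P * Z * (1 + N) * (a ^+ i.+1)%:P * Y)) e dA Nq).
  by rewrite [a ^+ i.+2]exprS [a ^+ i.+1]exprS !polyCM; ring.
have [-> -> ->] := h m; split; rewrite ?a'E ?b'E //.
Qed.
End AllLevels.

(** * Comparison with the modules of the classification *)

Section Forms.
Context (R : realType).
Local Notation C := R[i].
Implicit Types (q x c lambda alpha a b : C) (m : int) (i k : nat).
Implicit Types (w A B : int -> nat -> {poly C}) (h : int -> {poly C}).

(** The action of [Omega] on [1], where the [ddt] terms vanish, sorted as in [block_data];
    [omega_n_data] is the same for [Omega_n]. *)
Definition omega_data q lambda alpha (beta gamma : C * C) h w A B : Prop :=
  forall m i,
  [/\ w m i = ((i == 0%N)%:R * lambda ^ m)%:P * ('X - (m%:~R * q * alpha)%:P)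
        + ((m == 0)%:R * (i%:R == - (2%:R * q))%:R * gamma.1)%:P
        + ((i == 1%N)%:R * (q == - 1)%:R * beta.1 * lambda ^ m)%:P,
      A m i = ((i == 0%N)%:R * lambda ^ m)%:P
    & B m i = ((i == 0%N)%:R * lambda ^ m)%:P * (q%:P * (h m \Po (q^-1 *: 'X)))
        + ((m == 0)%:R * (i%:R == - (2%:R * q))%:R * gamma.2)%:P
        + ((i == 1%N)%:R * (q == - 1)%:R * lambda ^ m)%:P
          * (beta.2%:P + m%:~R * Theta alpha h beta.1)].

Definition omega_n_data (n : nat) lambda a b h w A B : Prop :=
  forall m i,
  [/\ w m i = (lambda ^ m * a ^+ i)%:P * 'X^(1 + i * n),
      A m i = (lambda ^ m * a ^+ i)%:P * 'X^(i * n) * (1 + (i * n)%:R)%:P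
    & B m i = (lambda ^ m * a ^+ i)%:P * 'X^(i * n)
        * ((n%:R^-1)%:P * (h m \Po (n%:R *: 'X)) - (m%:~R * i%:R)%:P)
        + (i%:R * b * lambda ^ m * a ^+ i.-1)%:P * 'X^(1 + i * n)].

Lemma XnsubC_divK alpha k :
  ('X^k - (alpha ^+ k)%:P) %/ ('X - alpha%:P) * ('X - alpha%:P)
  = 'X^k - (alpha ^+ k)%:P.
Proof.
by apply: divpK; rewrite dvdp_XsubCl rootE !hornerE subrr.
Qed.

(** The divided difference is linear, so [E] is the combination of the quotients in [hpoly]. Thus a
    family in [Tset] is determined by its member [h 1 = p]. *)
Lemma hpoly_sum alpha (p E : {poly C}) m :
  p - p.[alpha]%:P = E * ('X - alpha%:P) ->
  \sum_(i < size p) p`_i *: hpoly alpha m i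
  = m%:~R * p - (m * (m - 1))%:~R * alpha%:P * E.
Proof.
move=> pE; have XP : 'X - alpha%:P != 0 by rewrite polyXsubC_eq0.
have sE : \sum_(i < size p) p`_i *: ('X^i : {poly C}) = p.
  by rewrite -[RHS]coefK poly_def.
have sE' : \sum_(i < size p)
    p`_i *: (('X^i - (alpha ^+ i)%:P) %/ ('X - alpha%:P)) = E.
  apply: (mulIf XP); rewrite -pE mulr_suml.
  under eq_bigr do rewrite -scalerAl XnsubC_divK scalerBr.
  rewrite sumrB sE; congr (_ - _); rewrite horner_coef rmorph_sum /=.
  by apply: eq_bigr => i _; rewrite polyCM mul_polyC.
rewrite -[X in _ = _ * X - _]sE -sE' !mulr_sumr -sumrB; apply: eq_bigr => i _.
rewrite /hpoly -!mul_polyC !rmorphM /= !rmorph_int; ring.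
Qed.

(** The case [m = 1] forces [h 1 = q^-1 g(q t)], and substituting [q t] for [t] turns the divided
    difference at [x] into one at [x / q]. For [q = -1] this substitution cancels the sign change in
    [Theta], whose quotient becomes [D]. *)
Lemma exists_Tset q x (g D : {poly C}) : q != 0 ->
  g - g.[x]%:P = D * ('X - x%:P) ->
  exists h : int -> {poly C}, [/\ Tset (x / q) h,
    forall m, q%:P * (h m \Po (q^-1 *: 'X))
      = m%:~R * g - m%:~R * (m - 1)%:~R * x%:P * D
    & q = -1 -> forall c, Theta (x / q) h c = c%:P * D].
Proof.
move=> q0 gD; pose p := q^-1 *: (g \Po (q *: 'X)); pose E := D \Po (q *: 'X).
have qx : q * (x / q) = x by field.
have pE : p - p.[x / q]%:P = E * ('X - (x / q)%:P).
  have := congr1 (fun r => q^-1 *: (r \Po (q *: 'X))) gD => /=.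
  rewrite comp_polyB comp_polyC comp_polyM comp_polyB comp_polyX comp_polyC.
  rewrite /p /E hornerZ horner_comp hornerZ hornerX qx scalerBr => e.
  transitivity (q^-1 *: (g \Po q *: 'X) - q^-1 *: (g.[x])%:P).
    by rewrite -!mul_polyC polyCM.
  rewrite e scalerAr; congr (_ * _); rewrite scalerBr scalerA mulVf // scale1r.
  by rewrite -[q^-1 *: _]mul_polyC -polyCM mulrC.
pose h m := m%:~R * p - (m * (m - 1))%:~R * (x / q)%:P * E.
have hq (r : {poly C}) : (r \Po (q *: 'X)) \Po (q^-1 *: 'X) = r.
  by rewrite -comp_polyA comp_polyZ comp_polyX scalerA divff // scale1r comp_polyXr.
exists h; split.
- by exists (size p), (fun i => p`_i) => m; rewrite (hpoly_sum m pE).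
- move=> m; rewrite /h comp_polyB !comp_polyM.
  rewrite -!(rmorph_int (@polyC C)) !comp_polyC /p /E comp_polyZ !hq.
  rewrite -[q^-1 *: g]mul_polyC !polyCM.
  have qqP : q%:P * (q^-1)%:P = 1 by rewrite -polyCM divff.
  by apply: (lincomb1 (c := m%:~R * g - m%:~R * (m - 1)%:~R * x%:P * D) qqP); ring.
move=> q1 c; rewrite /Theta -mul_polyC; congr (_ * _).
have -> : h 1 = p by rewrite /h; ring.
have pN : p = - (g \Po (- 'X)).
  by rewrite /p q1 invrN1 !scaleN1r.
have xN : x / q = - x by rewrite q1 invrN1 mulrN1.
have cN (r s : {poly C}) : (- r) \Po s = - (r \Po s) by rewrite linearN.
rewrite pN xN cN -comp_polyA cN comp_polyX opprK comp_polyXr.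
rewrite hornerN horner_comp hornerN hornerX opprK !polyCN.
have -> : - 'X - - x%:P = - ('X - x%:P) by ring.
have -> : - g - - (g.[x])%:P = D * - ('X - x%:P) by rewrite mulrN -gD; ring.
by rewrite mulpK // oppr_eq0 polyXsubC_eq0.
Qed.
End Forms.

(** After the twist by [lam], the two outcomes are separated by whether [x = 0] and [1 / q] is a
    positive integer; otherwise [central_levelP] leaves only central levels and, for [q = -1], level
    1. *)
Lemma block_data_classification (R : realType) (q : R[i])
    (w A B : int -> nat -> {poly R[i]}) (c1 c2 : R[i]) :
  q != 0 -> block_data q w A B c1 c2 ->
  [/\ c1 = 0, c2 = 0 & exists2 lambda, lambda != 0 &
    (exists n, [/\ (0 < n)%N, q = n%:R^-1 & exists a b h,
       Tset 0 h /\ omega_n_data n lambda a b h w A B])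
    \/ exists alpha beta gamma h,
       Tset alpha h /\ omega_data q lambda alpha beta gamma h w A B].
Proof.
move=> q0 bd; have [lam [x [lam0 w1 wN1]]] := lead_data q0 bd.
pose tw (v : int -> nat -> {poly R[i]}) m i := (lam ^ (- m))%:P * v m i.
have twE v m i : v m i = (lam ^ m)%:P * tw v m i.
  by rewrite /tw mulrA -polyCM -expfzDr // subrr expr0z mul1r.
have bd' : block_data q (tw w) (tw A) (tw B) c1 c2 := twist_block_data lam0 bd.
have w1' : tw w 1 0%N = 'X - x%:P.
  by rewrite /tw w1 mulrA -polyCM exprN1 mulVf // mul1r.
have wN1' : tw w (-1) 0%N = 'X + x%:P.
  by rewrite /tw wN1 mulrA -polyCM opprK expr1z divff // mul1r.
have w0 := level0_w q0 bd' w1' wN1'; have A0 := level0_A q0 bd' w1' wN1'.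
have /factor_theorem[D gD] : root (tw B 1 0%N - (tw B 1 0%N).[x]%:P) x.
  by rewrite rootE hornerD hornerN hornerC subrr.
have B0 := level0_B q0 bd' w1' wN1' gD; have dg := level0_deriv gD.
split; [apply: (level0_c1 q0 bd' w1' wN1' gD) | exact: level0_c2 q0 bd' w1' wN1' |].
exists lam => //; move: (tw B 1 0%N) gD B0 dg => g gD B0 dg.
have [h [hT hB hTh]] := exists_Tset q0 gD.
have [[x0 [n nq]]|hn] := EM (x = 0 /\ exists n : nat, n.+1%:R * q = 1).
  left; exists n.+1; have qE : q = n.+1%:R^-1.
    apply: (mulfI (_ : n.+1%:R != 0)); first by rewrite pnatr_eq0.
    by rewrite nq divff // pnatr_eq0.
  split=> //; have [a [b lev]] := takiff_levels q0 bd' w0 A0 B0 dg x0 nq.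
  exists a, b, h; split; first by move: hT; rewrite x0 mul0r.
  move=> m i; rewrite (twE w) (twE A) (twE B).
  have hBm : (n.+1%:R^-1)%:P * (h m \Po (n.+1%:R *: 'X)) = m%:~R * g.
    by have := hB m; rewrite qE invrK x0 => ->; ring.
  rewrite hBm; case: i => [|i].
    by rewrite w0 A0 B0 x0 !mul0n expr0 addn0 expr1 expr0; split; ring.
  by have [-> -> ->] := lev m i.+1 isT; rewrite exprS; split; ring.
right; have cen := central_levelP q0 bd' w0 A0 B0 dg hn.
(* For [q = -1], level 1 is the one with [i + q = 0], and [beta] is its pair of constants from
   [level_neg]. *)
have [beta hbeta] : exists beta : R[i] * R[i], q = -1 -> forall m,
    [/\ tw w m 1%N = beta.1%:P, tw A m 1%N = 0
      & tw B m 1%N = beta.2%:P + m%:~R * beta.1%:P * D].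
  have [q1|/eqP q1] := eqVneq q (-1); last by exists (0, 0) => /q1.
  have [|c [d hcd]] := level_neg q0 bd' (i := 1) isT w0 A0 B0 dg.
    by rewrite q1 subrr.
  by exists (c, d).
have [gamma hgamma] : exists gamma : R[i] * R[i], forall i, (0 < i)%N ->
    ~~ ((i == 1%N) && (q == -1)) -> forall m,
    [/\ tw w m i = ((m == 0)%:R * (i%:R == - (2%:R * q))%:R * gamma.1)%:P,
        tw A m i = 0
      & tw B m i = ((m == 0)%:R * (i%:R == - (2%:R * q))%:R * gamma.2)%:P].
  have off i c : i%:R != - (2 * q) -> (i%:R + 2 * q) * c = 0 -> c = 0.
    by rewrite -addr_eq0 => /negPf iq /eqP; rewrite mulf_eq0 iq => /eqP.
  (* At most one level equals [- 2q], so a single [gamma] read there serves all levels; without such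
     a level it is set to [(0, 0)]. *)
  have [[k k0 /andP[kq /eqP kE]]|nk] := EM (exists2 k, (0 < k)%N &
      ~~ ((k == 1%N) && (q == -1)) && (k%:R == - (2 * q))).
    have [c [d [_ _ hk]]] := cen k k0 kq; exists (c, d) => i i0 iq m.
    have [ik|ik] := eqVneq (i%:R) (- (2 * q)).
      have -> : i = k by apply/eqP; rewrite -(eqr_nat R[i]) ik kE.
      by rewrite mulr1.
    have [c' [d' [c0 d0 hi]]] := cen i i0 iq; have [-> -> ->] := hi m.
    by rewrite (off _ _ ik c0) (off _ _ ik d0) !(mulr0, mul0r).
  exists (0, 0) => i i0 iq m; have [c' [d' [c0 d0 hi]]] := cen i i0 iq.
  have ik : i%:R != - (2 * q).
    by apply/negP => ik; case: nk; exists i => //; rewrite iq.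
  have [-> -> ->] := hi m.
  by rewrite (off _ _ ik c0) (off _ _ ik d0) !mulr0.
exists (x / q), beta, gamma, h; split=> // m i; rewrite (twE w) (twE A) (twE B).
have qx : q * (x / q) = x by field.
rewrite hB -mulrA qx; case: i => [|i].
  have -> : (0 == - (2%:R * q)) = false.
    by rewrite eq_sym oppr_eq0 mulf_eq0 pnatr_eq0 (negPf q0).
  by rewrite w0 A0 B0 /=; split; ring.
have [/andP[/eqP-> /eqP q1]|iq] := boolP ((i.+1 == 1%N) && (q == -1)).
  have [-> -> ->] := hbeta q1 m; rewrite hTh // q1 !eqxx.
  have -> : (1%:R == - (2%:R * -1) :> R[i]) = false.
    by rewrite mulrN1 opprK eqr_nat.
  by rewrite /=; split; ring.
have [-> -> ->] := hgamma i.+1 isT iq m.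
have -> : (i.+1 == 1%N)%:R * (q == -1)%:R = 0 :> R[i].
  by rewrite -natrM mulnb (negPf iq).
rewrite /=; have [->|m0] := eqVneq m 0; last by rewrite !mul0r; split; ring.
by rewrite expr0z; split; ring.
Qed.

(** * Sums over the coefficients of a polynomial *)

Lemma sum_coef_widen (A : nzSemiRingType) (V : nmodType) (F : nat -> A -> V)
    (p : {poly A}) n : (forall i, F i 0 = 0) -> (size p <= n)%N ->
  \sum_(i < size p) F i p`_i = \sum_(i < n) F i p`_i.
Proof.
move=> F0 pn; rewrite (big_ord_widen n (fun i => F i p`_i)) // big_mkcond /=.
by apply: eq_bigr => i _; case: ltnP => // ip; rewrite nth_default.
Qed.

Lemma sum_coefD (A : nzRingType) (V : nmodType) (F : nat -> A -> V)
    (p r : {poly A}) : (forall i, F i 0 = 0) ->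
  (forall i, {morph F i : x y / x + y}) ->
  \sum_(i < size (p + r)) F i (p + r)`_i
  = \sum_(i < size p) F i p`_i + \sum_(i < size r) F i r`_i.
Proof.
move=> F0 FD; have sD := size_polyD p r.
rewrite !(sum_coef_widen (n := maxn (size p) (size r))) ?leq_maxl ?leq_maxr //.
by rewrite -big_split; apply: eq_bigr => i _; rewrite coefD FD.
Qed.

Lemma sum_coefXM (A : nzRingType) (V : nmodType) (F : nat -> A -> V)
    (p : {poly A}) : (forall i, F i 0 = 0) ->
  \sum_(i < size ('X * p)) F i ('X * p)`_i = \sum_(i < size p) F i.+1 p`_i.
Proof.
move=> F0; rewrite (sum_coef_widen (n := (size p).+1)) //.
  rewrite big_ord_recl coefXM eqxx F0 add0r.
  by apply: eq_bigr => i _; rewrite coefXM.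
by rewrite (leq_trans (size_polyMleq _ _)) // size_polyX.
Qed.

Lemma size_polyCM_leq (A : nzRingType) (a : A) (p : {poly A}) :
  (size (a%:P * p)%R <= size p)%N.
Proof. by rewrite mul_polyC size_scale_leq. Qed.

(** * The module structure on [C[t,s]] *)

Section Enveloping.
Context (R : realType).
Local Notation C := R[i].
Context (M : lmodType C) (S T : M -> M) (v0 : M).
Context (Slin : linear S) (Tlin : linear T).
Context (ST : forall v, S (T v) = T (S v)).
(** [Uh_act] with the actions of [L_{0,0}] and [W_{0,0}] abstracted to operators [S] and [T], so
    that its compatibility with [s] and [t] rests only on their linearity and commutation. *)
Definition poly_act (u : Cts R) : M :=
  \sum_(i < size u) \sum_(j < size u`_i) u`_i`_j *: iter i S (iter j T v0).
Local Notation psi := poly_act.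

Let F i (p : {poly C}) : M :=
  \sum_(j < size p) p`_j *: iter i S (iter j T v0).

Let F0 i : F i 0 = 0. Proof. by rewrite /F size_poly0 big_ord0. Qed.

Let FD i : {morph F i : x y / x + y}.
Proof.
move=> x y; rewrite /F (@sum_coefD _ _ (fun j c => c *: iter i S (iter j T v0))) //.
  by move=> j; rewrite scale0r.
by move=> j a b; rewrite scalerDl.
Qed.

Let FZ i c p : F i (c *: p) = c *: F i p.
Proof.
rewrite /F (@sum_coef_widen _ _ (fun j c => c *: iter i S (iter j T v0))
  (c *: p) (size p)) ?size_scale_leq //; last by move=> j; rewrite scale0r.
by rewrite scaler_sumr; apply: eq_bigr => j _; rewrite coefZ scalerA.
Qed.

Lemma linear_sum_fun (f : M -> M) n (E : 'I_n -> M) (a : 'I_n -> C) : linear f ->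
  f (\sum_(j < n) a j *: E j) = \sum_(j < n) a j *: f (E j).
Proof.
move=> lf; have fD : {morph f : u v / u + v}.
  by move=> u v; have := lf 1 u v; rewrite !scale1r.
have f0 : f 0 = 0 by have := lf (-1) 0 0; rewrite scaler0 addr0 scaleN1r addNr.
rewrite (big_morph f fD f0); apply: eq_bigr => j _.
by have := lf (a j) (E j) 0; rewrite f0 !addr0.
Qed.

Lemma poly_act_linear c u v : psi (cst c * u + v) = c *: psi u + psi v.
Proof.
rewrite /poly_act -!/(F _ _) (sum_coefD _ _ F0 FD); congr (_ + _).
have -> : \sum_(i < size (cst c * u)) F i (cst c * u)`_i
    = \sum_(i < size u) F i (cst c * u)`_i.
  exact: (sum_coef_widen F0 (size_polyCM_leq _ _)).
rewrite scaler_sumr; apply: eq_bigr => i _.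
by rewrite /cst coefCM mul_polyC FZ.
Qed.

Lemma poly_act_s u : psi (s_ R * u) = S (psi u).
Proof.
rewrite /poly_act -!/(F _ _) (sum_coefXM _ F0).
rewrite -[RHS]/(S (\sum_(i < size u) F i u`_i)).
have -> : \sum_(i < size u) F i u`_i = \sum_(i < size u) 1 *: F i u`_i.
  by apply: eq_bigr => i _; rewrite scale1r.
rewrite (linear_sum_fun _ _ Slin); apply: eq_bigr => i _; rewrite scale1r.
by rewrite /F (linear_sum_fun _ _ Slin).
Qed.

Lemma poly_act_t u : psi (t_ R * u) = T (psi u).
Proof.
have iterST i v : iter i S (T v) = T (iter i S v).
  by elim: i => [//|i IH]; rewrite !iterS IH ST.
have FX i p : F i ('X * p) = T (F i p).
  rewrite /F (sum_coefXM (F := fun j c => c *: iter i S (iter j T v0))).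
    rewrite (linear_sum_fun _ _ Tlin); apply: eq_bigr => j _.
    by rewrite -iterST.
  by move=> j; rewrite scale0r.
rewrite /poly_act -!/(F _ _).
rewrite -[RHS]/(T (\sum_(i < size u) F i u`_i)).
have -> : \sum_(i < size (t_ R * u)) F i (t_ R * u)`_i
    = \sum_(i < size u) F i (t_ R * u)`_i.
  exact: (sum_coef_widen F0 (size_polyCM_leq _ _)).
have -> : \sum_(i < size u) F i u`_i = \sum_(i < size u) 1 *: F i u`_i.
  by apply: eq_bigr => i _; rewrite scale1r.
rewrite (linear_sum_fun _ _ Tlin); apply: eq_bigr => i _.
by rewrite scale1r /t_ /in_t coefCM FX.
Qed.

End Enveloping.

Lemma scalar_const (A : pzRingType) (P : A -> A) c :
  (forall u v, P (c * u + v) = c * P u + P v) -> P 0 = 0 -> P c = c * P 1.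
Proof. by move=> /(_ 1 0) + P0; rewrite P0 mulr1 !addr0. Qed.

(** * Operators on C[t,s] determined by their value at 1 *)

Section Cts.
Context (R : realType).
Local Notation C := R[i].
Local Notation Cts := (Cts R).
Local Notation s_ := (s_ R).
Local Notation t_ := (t_ R).
Implicit Types (c : C) (p : {poly C}) (u v f : Cts).

Lemma Cts_ind (P : Cts -> Prop) : (forall c, P (cst c)) ->
  (forall u v, P u -> P v -> P (u + v)) -> (forall u, P u -> P (t_ * u)) ->
  (forall u, P u -> P (s_ * u)) -> forall u, P u.
Proof.
move=> Pc PD Pt Ps; elim/poly_ind => [|u p IH]; first exact: Pc 0.
rewrite mulrC; apply: (PD (s_ * u) (in_t p)); first exact: Ps.
elim/poly_ind: p => [|p c IHp]; first exact: Pc 0.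
have -> : in_t (p * 'X + c%:P) = t_ * in_t p + cst c.
  by rewrite /in_t polyCD polyCM mulrC.
by apply: PD => //; apply: Pt.
Qed.

Lemma in_tD p r : in_t (p + r) = in_t p + in_t r. Proof. exact: polyCD. Qed.
Lemma in_tM p r : in_t (p * r) = in_t p * in_t r. Proof. exact: polyCM. Qed.
Lemma shiftD c u v : shift c (u + v) = shift c u + shift c v.
Proof. exact: comp_polyD. Qed.
Lemma shiftM c u v : shift c (u * v) = shift c u * shift c v.
Proof. exact: comp_polyM. Qed.
Lemma shift_in_t c p : shift c (in_t p) = in_t p.
Proof. exact: comp_polyC. Qed.
Lemma shift_cst c d : shift c (cst d) = cst d.
Proof. exact: comp_polyC. Qed.
Lemma shift_s c : shift c s_ = s_ - cst c.
Proof. exact: comp_polyX. Qed.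
Lemma shift_shift c d u : shift c (shift d u) = shift (c + d) u.
Proof.
rewrite /shift -comp_polyA comp_polyB comp_polyX comp_polyC /cst !polyCD.
by rewrite opprD addrA.
Qed.
Lemma shift0 u : shift 0 u = u.
Proof. by rewrite /shift /cst !polyC0 subr0 comp_polyXr. Qed.

Lemma ddtD u v : ddt (u + v) = ddt u + ddt v.
Proof.
by apply/polyP => k; rewrite coefD !coef_map_id0 ?derivC ?deriv0 // coefD derivD.
Qed.
Lemma ddt_in_t p u : ddt (in_t p * u) = in_t p^`() * u + in_t p * ddt u.
Proof.
apply/polyP => k; rewrite coefD !coefCM !coef_map_id0 ?deriv0 //.
by rewrite coefCM derivM.
Qed.
Lemma ddt_s u : ddt (s_ * u) = s_ * ddt u.
Proof.
apply/polyP => k; rewrite coefXM !coef_map_id0 ?deriv0 // coefXM.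
by case: k => //=; rewrite deriv0.
Qed.
Lemma ddt_polyC p : ddt (in_t p) = in_t p^`().
Proof.
apply/polyP => k; rewrite /ddt coef_map_id0; last exact: deriv0.
rewrite (coefC p k) (coefC p^`() k).
by case: (k == 0%N); last exact: deriv0.
Qed.
Lemma ddt_cst c : ddt (cst c) = 0.
Proof. by rewrite ddt_polyC derivC /in_t polyC0. Qed.
Lemma ddtZs c u : ddt ((s_ - cst c) * u) = (s_ - cst c) * ddt u.
Proof.
have -> : (s_ - cst c) * u = s_ * u + in_t (- c%:P) * u.
  by rewrite /cst /in_t polyCN; ring.
rewrite ddtD ddt_s ddt_in_t derivN derivC oppr0 /in_t polyC0 mul0r add0r polyCN.
by rewrite /cst; ring.
Qed.

(** Both sides obey the same rules for [s], [t] and constants, which generate C[t,s]. For [W_{m,i}]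
    the shift is [c = m q], for central elements it is 0. *)
Lemma commuting_shift (P : Cts -> Cts) c :
  (forall a u v, P (cst a * u + v) = cst a * P u + P v) ->
  (forall u, P (t_ * u) = t_ * P u) ->
  (forall u, P (s_ * u) = (s_ - cst c) * P u) ->
  forall u, P u = shift c u * P 1.
Proof.
move=> Plin Pt Ps; have PD u v : P (u + v) = P u + P v.
  have e1 : cst 1 = 1 :> Cts by rewrite /cst !polyC1.
  by have := Plin 1 u v; rewrite e1 !mul1r.
have P0 : P 0 = 0.
  by have /eqP := PD 0 0; rewrite addr0 -subr_eq subrr eq_sym => /eqP.
elim/Cts_ind => [a|u v IHu IHv|u IH|u IH].
- exact: etrans (scalar_const (Plin a) P0)
    (congr1 (fun z => z * P 1) (esym (shift_cst c a))).
- by rewrite PD IHu IHv shiftD; ring.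
- by rewrite Pt IH shiftM shift_in_t; ring.
- by rewrite Ps IH shiftM shift_s; ring.
Qed.

(** The bracket of [L_{m,i}] with [W_{0,0}] adds the defect [- c W u] to multiplication by [t]; the
    Leibniz rule for [ddt] reproduces exactly this defect. *)
Lemma derivation_shift (P W : Cts -> Cts) c :
  (forall a u v, P (cst a * u + v) = cst a * P u + P v) ->
  (forall u, P (t_ * u) = t_ * P u - cst c * W u) ->
  (forall u, W u = shift c u * W 1) ->
  (forall u, P (s_ * u) = (s_ - cst c) * P u) ->
  forall u, P u = shift c u * P 1 - cst c * W 1 * ddt (shift c u).
Proof.
move=> Plin Pt WE Ps; have PD u v : P (u + v) = P u + P v.
  have e1 : cst 1 = 1 :> Cts by rewrite /cst !polyC1.
  by have := Plin 1 u v; rewrite e1 !mul1r.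
have P0 : P 0 = 0.
  by have /eqP := PD 0 0; rewrite addr0 -subr_eq subrr eq_sym => /eqP.
elim/Cts_ind => [a|u v IHu IHv|u IH|u IH].
- apply: (etrans (scalar_const (Plin a) P0)).
  by rewrite shift_cst ddt_cst mulr0 subr0.
- by rewrite PD IHu IHv shiftD ddtD; ring.
- rewrite Pt IH (WE u) /t_ shiftM shift_in_t ddt_in_t derivX /in_t polyC1.
  by ring.
- by rewrite Ps IH shiftM shift_s ddtZs; ring.
Qed.

End Cts.

(** * Module relations on C[t,s] and their values at 1 *)

Section BlockModule.
Context (R : realType).
Local Notation C := R[i].
Local Notation Cts := (Cts R).
Local Notation s_ := (s_ R).
Local Notation t_ := (t_ R).
Local Notation cocycle := (block_cocycle R).

Record block_module (q : C) (op : block_idx -> Cts -> Cts) : Prop := BlockModule {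
  bm_linear k c u v : op k (cst c * u + v) = cst c * op k u + op k v;
  bm_s f : op (IL 0 0) f = s_ * f;
  bm_t f : op (IW 0 0) f = t_ * f;
  bm_LL m i n j f :
    op (IL m i) (op (IL n j) f) - op (IL n j) (op (IL m i) f)
    = cst (block_coef q m i n j) * op (IL (m + n) (i + j)%N) f
      + cst (cocycle m i n j) * op IC1 f;
  bm_LW m i n j f :
    op (IL m i) (op (IW n j) f) - op (IW n j) (op (IL m i) f)
    = cst (block_coef q m i n j) * op (IW (m + n) (i + j)%N) f
      + cst (cocycle m i n j) * op IC2 f;
  bm_WW m i n j f : op (IW m i) (op (IW n j) f) = op (IW n j) (op (IW m i) f);
  bm_C1 k f : op IC1 (op k f) = op k (op IC1 f);
  bm_C2 k f : op IC2 (op k f) = op k (op IC2 f)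
}.

(* The values [W m i], [L m i], [Z1], [Z2] at [1] of the operators of [W_{m,i}],
   [L_{m,i}], [C_1], [C_2]. *)
Record unit_data (q : C) (W L : int -> nat -> Cts) (Z1 Z2 : Cts) : Prop :=
  UnitData {
  ud_W0 : W 0 0%N = t_;
  ud_L0 : L 0 0%N = s_;
  ud_LL m i n j :
    shift (m%:~R * q) (L n j) * L m i
    - cst (m%:~R * q) * W m i * ddt (shift (m%:~R * q) (L n j))
    - (shift (n%:~R * q) (L m i) * L n j
       - cst (n%:~R * q) * W n j * ddt (shift (n%:~R * q) (L m i)))
    = cst (block_coef q m i n j) * L (m + n) (i + j)%N
      + cst (cocycle m i n j) * Z1;
  ud_LW m i n j :
    shift (m%:~R * q) (W n j) * L m i
    - cst (m%:~R * q) * W m i * ddt (shift (m%:~R * q) (W n j))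
    - shift (n%:~R * q) (L m i) * W n j
    = cst (block_coef q m i n j) * W (m + n) (i + j)%N
      + cst (cocycle m i n j) * Z2;
  ud_WW m i n j :
    shift (m%:~R * q) (W n j) * W m i = shift (n%:~R * q) (W m i) * W n j;
  ud_ZW Z m i : Z = Z1 \/ Z = Z2 -> W m i * Z = shift (m%:~R * q) Z * W m i;
  ud_ZL Z m i : Z = Z1 \/ Z = Z2 -> L m i * Z = shift (m%:~R * q) Z * L m i
    - cst (m%:~R * q) * W m i * ddt (shift (m%:~R * q) Z)
}.

Section UnitValues.
Context (q : C) (op : block_idx -> Cts -> Cts) (bm : block_module q op).
Implicit Types (m n : int) (i j : nat) (k : block_idx) (f u v : Cts).

Lemma cocycle0 i n j : cocycle 0 i n j = 0.
Proof. by rewrite /block_cocycle expr0n subrr !mul0r. Qed.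

Lemma cocycle_0 m i j : cocycle m i 0 j = 0.
Proof.
rewrite /block_cocycle addr0; have [->|_] := eqVneq m 0.
  by rewrite expr0n subrr !mul0r.
by rewrite andbF mulr0.
Qed.

Lemma op_linear k c : forall u v, op k (cst c * u + v) = cst c * op k u + op k v.
Proof. exact: (bm_linear bm k c). Qed.

Lemma coef_s n j : block_coef q 0 0 n j = n%:~R * q.
Proof. by rewrite /block_coef; ring. Qed.

Lemma op_IW_s m i u : op (IW m i) (s_ * u) = (s_ - cst (m%:~R * q)) * op (IW m i) u.
Proof.
have := bm_LW bm 0 0 m i u; rewrite !(bm_s bm) cocycle0 coef_s add0r add0n => h.
by apply: (lincomb1 (c := -1) h); rewrite /cst polyC0; ring.
Qed.

Lemma op_IL_s m i u : op (IL m i) (s_ * u) = (s_ - cst (m%:~R * q)) * op (IL m i) u.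
Proof.
have := bm_LL bm 0 0 m i u; rewrite !(bm_s bm) cocycle0 coef_s add0r add0n => h.
by apply: (lincomb1 (c := -1) h); rewrite /cst polyC0; ring.
Qed.

Lemma op_IW_t m i u : op (IW m i) (t_ * u) = t_ * op (IW m i) u.
Proof. by rewrite -!(bm_t bm) (bm_WW bm). Qed.

Lemma op_IL_t m i u : op (IL m i) (t_ * u)
  = t_ * op (IL m i) u - cst (m%:~R * q) * op (IW m i) u.
Proof.
have := bm_LW bm m i 0 0 u; rewrite !(bm_t bm) cocycle_0 addr0 addn0.
have -> : block_coef q m i 0 0 = - (m%:~R * q) by rewrite /block_coef; ring.
by move=> h; apply: (lincomb1 (c := 1) h); rewrite /cst !polyCN polyC0; ring.
Qed.

Lemma op_IW m i u : op (IW m i) u = shift (m%:~R * q) u * op (IW m i) 1.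
Proof.
apply: commuting_shift => [a u' v'|u'|u'].
- exact: op_linear.
- exact: op_IW_t.
- exact: op_IW_s.
Qed.

Lemma op_IL m i u : op (IL m i) u = shift (m%:~R * q) u * op (IL m i) 1
  - cst (m%:~R * q) * op (IW m i) 1 * ddt (shift (m%:~R * q) u).
Proof.
apply: (derivation_shift (W := op (IW m i))) => [a u' v'|u'|u'|u'].
- exact: op_linear.
- exact: op_IL_t.
- exact: op_IW.
- exact: op_IL_s.
Qed.

Lemma op_central k u : k = IC1 \/ k = IC2 -> op k u = u * op k 1.
Proof.
move=> hk; have com l f : op k (op l f) = op l (op k f).
  by case: hk => ->; [exact: bm_C1 bm _ _ | exact: bm_C2 bm _ _].
rewrite -[X in X * _]shift0; apply: commuting_shift => [a u' v'|u'|u'].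
- exact: op_linear.
- by rewrite -!(bm_t bm) com.
- have -> : cst 0 = 0 :> Cts by rewrite /cst !polyC0.
  by rewrite subr0 -!(bm_s bm) com.
Qed.

Lemma block_module_unit_data : unit_data q
  (fun m i => op (IW m i) 1) (fun m i => op (IL m i) 1) (op IC1 1) (op IC2 1).
Proof.
have sub (a b c d : Cts) : a = c -> b = d -> a - b = c - d by move=> -> ->.
have Z12 Z : Z = op IC1 1 \/ Z = op IC2 1 ->
    exists2 k, Z = op k 1 & k = IC1 \/ k = IC2.
  by case=> ->; [exists IC1 | exists IC2]; rewrite //; [left | right].
have com k l f : k = IC1 \/ k = IC2 -> op k (op l f) = op l (op k f).
  by case=> ->; [exact: bm_C1 bm _ _ | exact: bm_C2 bm _ _].
split.
- exact: etrans (bm_t bm 1) (mulr1 _).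
- exact: etrans (bm_s bm 1) (mulr1 _).
- move=> m i n j.
  exact: etrans (esym (sub _ _ _ _ (op_IL m i _) (op_IL n j _)))
    (bm_LL bm m i n j 1).
- move=> m i n j.
  exact: etrans (esym (sub _ _ _ _ (op_IL m i _) (op_IW n j _)))
    (bm_LW bm m i n j 1).
- move=> m i n j.
  exact: etrans (esym (op_IW m i _)) (etrans (bm_WW bm m i n j 1) (op_IW n j _)).
- move=> Z m i /Z12[k -> hk].
  exact: etrans (esym (op_central _ hk)) (etrans (com _ _ _ hk) (op_IW m i _)).
- move=> Z m i /Z12[k -> hk].
  exact: etrans (esym (op_central _ hk)) (etrans (com _ _ _ hk) (op_IL m i _)).
Qed.

End UnitValues.

Section UnitData.
Context (q : C) (W L : int -> nat -> Cts) (Z1 Z2 : Cts).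
Context (q0 : q != 0) (vd : unit_data q W L Z1 Z2).
Implicit Types (m n : int) (i j : nat) (f u v : Cts).

Lemma shift_periodic c f : c != 0 -> shift c f = f -> f = in_t f`_0.
Proof.
move=> c0 fc; apply: (@polyC_periodic _ c%:P f _ fc) => k.
rewrite -[k.+1%:R](rmorph_nat (@polyC C)) -polyCM polyC_eq0.
by rewrite mulf_neq0 // pnatr_eq0.
Qed.

(** Otherwise the bracket with [L_{-m,0}] reads [0 = 2 m q t]; for these [m] it has no central
    term. *)
Lemma ud_W_neq0 m : m = 1 \/ m = -1 -> W m 0%N != 0.
Proof.
move=> hm; apply/negP => /eqP w0; have := ud_LW vd (- m) 0 m 0.
have -> : cocycle (- m) 0 m 0 = 0.
  by rewrite /block_cocycle; case: hm => ->; rewrite subrr !mul0r.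
have -> : block_coef q (- m) 0 m 0 = 2 * m%:~R * q by rewrite /block_coef; ring.
rewrite addNr (ud_W0 vd) w0.
have sh0 c : shift c 0 = 0 by exact: comp_poly0.
have ddt0 : ddt (0 : Cts) = 0 by exact: map_poly0.
have c00 : cst (0 : C) = 0 by rewrite /cst !polyC0.
rewrite sh0 ddt0 c00 !(mul0r, mulr0, subr0, addr0).
move=> /esym/eqP; rewrite mulf_eq0 !polyC_eq0 polyX_eq0 orbF.
rewrite !mulf_eq0 pnatr_eq0 (negPf q0) orbF /= intr_eq0.
by case: hm => ->.
Qed.

(** Since [W_{1,0}] and [W_{-1,0}] commute, [shift q wN * w1] is periodic in [s], hence lies in
    C[t]. It is nonzero, so both of its factors have degree 0 in [s]. *)
Lemma ud_W1_in_t : W 1 0%N = in_t (W 1 0%N)`_0.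
Proof.
have w10 : W 1 0%N != 0 by apply: ud_W_neq0; left.
have wN0 : W (-1) 0%N != 0 by apply: ud_W_neq0; right.
have h := ud_WW vd 1 0 (-1) 0; rewrite mul1r mulN1r in h.
move: (W 1 0%N) (W (-1) 0%N) w10 wN0 h => w1 wN w10 wN0 h.
have shN0 : shift q wN != 0.
  apply/negP => /eqP e; move/negP: wN0; apply; apply/eqP.
  by rewrite -[wN]shift0 -(addNr q) -shift_shift e /shift comp_poly0.
have FE : shift q wN * w1 = in_t (shift q wN * w1)`_0.
  apply: (@shift_periodic (- q)); first by rewrite oppr_eq0.
  by rewrite shiftM shift_shift addNr shift0 mulrC -h.
have F0 : shift q wN * w1 != 0 by exact: mulf_neq0.
have sF : (size (shift q wN * w1)%R <= 1)%N.
  by rewrite FE size_polyC leq_b1.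
apply: size1_polyC; rewrite size_mul // in sF.
move: shN0 w10 sF; rewrite -!size_poly_gt0.
by move: (size (shift q wN)) (size w1) => a b; lia.
Qed.

(** With [W_{1,0}] acting through an element of C[t], commuting with it makes [W n j] periodic. *)
Lemma ud_W_in_t n j : W n j = in_t (W n j)`_0.
Proof.
have w10 : W 1 0%N != 0 by apply: ud_W_neq0; left.
apply: (@shift_periodic q) => //; apply: (mulIf w10).
have := ud_WW vd 1 0 n j; rewrite mul1r => ->.
by rewrite ud_W1_in_t shift_in_t mulrC.
Qed.

(** Commuting with [W_{1,0}] removes [s]; commuting with [L_{1,0}], which differentiates in [t],
    then removes [t]. *)
Lemma ud_Z_cst Z : Z = Z1 \/ Z = Z2 -> Z = cst Z`_0`_0.
Proof.
move=> hZ; have w10 : W 1 0%N != 0 by apply: ud_W_neq0; left.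
have ZW := ud_ZW vd 1 0 hZ; have ZL := ud_ZL vd 1 0 hZ; rewrite !(mul1r q) in ZW ZL.
have Zt : Z = in_t Z`_0.
  by apply: (@shift_periodic q) => //; apply: (mulIf w10); rewrite -ZW mulrC.
rewrite {1}Zt /cst; congr (_%:P); apply: deriv_eq0.
have dZ : ddt Z = in_t (Z`_0)^`().
  exact: etrans (congr1 (@ddt R) Zt) (ddt_polyC _).
have : cst q * W 1 0%N * in_t (Z`_0)^`() = 0.
  rewrite -dZ; have sZ : shift q Z = Z by rewrite Zt shift_in_t.
  rewrite sZ in ZL.
  by apply: (lincomb1 (c := 1) ZL); ring.
move/eqP; rewrite !mulf_eq0 (negPf w10) !polyC_eq0 (negPf q0) /=.
by move/eqP.
Qed.

(** In the bracket with [W_{1,0}] everything except [l - shift q l] lies in C[t], so this difference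
    does too, and a polynomial with such a difference is affine in [s]. *)
Lemma ud_L_affine m i : L m i = s_ * in_t (L m i)`_1 + in_t (L m i)`_0.
Proof.
have w10 : W 1 0%N != 0 by apply: ud_W_neq0; left.
have := ud_LW vd m i 1 0; rewrite (mul1r q).
rewrite (ud_W_in_t (m + 1)) (ud_W_in_t m) (ud_Z_cst (or_intror erefl)).
move: ud_W1_in_t w10; move: (W 1 0%N)`_0 => p -> p0.
rewrite shift_in_t ddt_polyC.
move: (L m i) (cocycle m i 1 0) => l cc h; pose D : Cts := l - shift q l.
have [r hr] : exists r, in_t p * D = in_t r.
  exists ((m%:~R * q)%:P * (W m i)`_0 * p^`()
     + (block_coef q m i 1 0)%:P * (W (m + 1) (i + 0)%N)`_0
     + (cc * Z2`_0`_0)%:P).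
  rewrite !in_tD !in_tM /D mulrBr.
  by apply: (lincomb1 (c := 1) h); rewrite /cst /in_t !polyCM; ring.
have DE : D = in_t D`_0.
  apply/polyP => -[|k]; rewrite coefC //=.
  have := congr1 (fun f : Cts => f`_k.+1) hr.
  rewrite /in_t coefCM coefC /= => /eqP; rewrite mulf_eq0.
  by rewrite polyC_eq0 in p0; rewrite (negPf p0) => /eqP.
(* A shift by [q] changes [q l] and [s D] by the same amount [- q D]. *)
have L2E : cst q * l - s_ * D = in_t (cst q * l - s_ * D)`_0.
  apply: (@shift_periodic q) => //.
  have sD : shift q D = D by rewrite DE shift_in_t.
  have sl : shift q l = l - D by rewrite /D; ring.
  rewrite /shift comp_polyB -!/(shift _ _) !shiftM shift_cst shift_s sD sl.
  by ring.
apply/polyP => -[|[|k]].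
- by rewrite coefD coefXM !coefC /= add0r.
- by rewrite coefD coefXM !coefC /= addr0.
rewrite coefD coefXM !coefC /= addr0.
have := congr1 (fun f : Cts => f`_k.+2) L2E.
rewrite coefB coefCM coefXM DE !coefC /= subr0 => /eqP.
by rewrite mulf_eq0 polyC_eq0 (negPf q0) => /eqP.
Qed.

Lemma coef0_s (u v : Cts) (p r : {poly C}) :
  s_ * u + in_t p = s_ * v + in_t r -> p = r.
Proof.
by move/(congr1 (fun f : Cts => f`_0)); rewrite !coefD !coefXM !coefC /= !add0r.
Qed.

Lemma unit_block_data : block_data q (fun m i => (W m i)`_0)
  (fun m i => (L m i)`_1) (fun m i => (L m i)`_0) Z1`_0`_0 Z2`_0`_0.
Proof.
have shL c A B : shift c (s_ * in_t A + in_t B) = (s_ - cst c) * in_t A + in_t B.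
  by rewrite shiftD shiftM shift_s !shift_in_t.
have dshL c A B : ddt ((s_ - cst c) * in_t A + in_t B)
    = (s_ - cst c) * in_t A^`() + in_t B^`().
  by rewrite ddtD ddtZs !ddt_polyC.
have bcE m i n j : bcoef q m i n j = (block_coef q m i n j)%:P.
  by rewrite /bcoef /block_coef; ring.
split.
- by rewrite (ud_W0 vd) coefC.
- by rewrite (ud_L0 vd) coefX.
- by rewrite (ud_L0 vd) coefX.
- move=> m i n j; rewrite bcE /bcocycle -/(block_cocycle R m i n j).
  have h := ud_LW vd m i n j.
  rewrite (ud_W_in_t n j) (ud_W_in_t (m + n)) (ud_W_in_t m i) (ud_L_affine m i)
    (ud_Z_cst (or_intror erefl)) shL shift_in_t ddt_polyC in h.
  move: (block_coef _ _ _ _ _) (block_cocycle _ _ _ _ _) h => bc cc h.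
  apply: polyC_inj; rewrite -!/(in_t _).
  by apply: (lincomb1 (c := 1) h); rewrite /cst /in_t; ring.
- move=> m i n j; rewrite bcE /bcocycle -/(block_cocycle R m i n j).
  have h := ud_LL vd m i n j.
  rewrite (ud_W_in_t n j) (ud_W_in_t m i) (ud_L_affine m i) (ud_L_affine n j)
    (ud_L_affine (m + n)) (ud_Z_cst (or_introl erefl)) !shL !dshL in h.
  move: (block_coef _ _ _ _ _) (block_cocycle _ _ _ _ _) h => bc cc.
  move: (W n j)`_0 (W m i)`_0 (L m i)`_1 (L m i)`_0 (L n j)`_1 (L n j)`_0.
  move: (L (m + n) _)`_1 (L (m + n) _)`_0 Z1`_0`_0.
  move=> A B z wn wm Am Bm An Bn h.
  pose M := (m%:~R * q)%:P : {poly C}; pose N := (n%:~R * q)%:P : {poly C}.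
  (* The coefficients of [s] on both sides are supplied explicitly, so that [coef0_s] extracts the
     part free of [s]. *)
  apply: (@coef0_s
    (in_t (An * Bm + (Bn - M * An) * Am - M * wm * An^`()
     - (Am * Bn + (Bm - N * Am) * An - N * wn * Am^`()))) (in_t (bc%:P * A))).
  by apply: (lincomb1 (c := 1) h); rewrite /M /N /cst /in_t; ring.
Qed.

End UnitData.
End BlockModule.

(** * Recovering the modules from their data *)

Section Isomorphism.
Context (R : realType).
Local Notation C := R[i].
Local Notation Cts := (Cts R).
Local Notation s_ := (s_ R).
Local Notation t_ := (t_ R).
Context (q : C) (op : block_idx -> Cts -> Cts) (w A B : int -> nat -> {poly C}).
Context (opW : forall m i f,
  op (IW m i) f = shift (m%:~R * q) f * in_t (w m i)).
Context (opL : forall m i f, op (IL m i) f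
  = shift (m%:~R * q) f * (s_ * in_t (A m i) + in_t (B m i))
    - cst (m%:~R * q) * in_t (w m i) * ddt (shift (m%:~R * q) f)).
Context (opC1 : forall f, op IC1 f = 0) (opC2 : forall f, op IC2 f = 0).

Lemma op_Omega lambda alpha beta gamma h :
  omega_data q lambda alpha beta gamma h w A B ->
  forall k f, op k f = Omega q lambda alpha beta gamma h k f.
Proof.
(* The action splits into its level-zero, [gamma] and [beta] parts. The [gamma] part is supported at
   [m = 0], where the shift is trivial, and the [beta] part at [q = -1], where the shift by [m q] is
   one by [- m]. *)
have add3 (P S0 x1 x2 x3 y1 y2 y3 c P' z1 z2 z3 : Cts) :
    z1 = P * (S0 + x1) - c * y1 * P' -> z2 = P * x2 - c * y2 * P' ->
    z3 = P * x3 - c * y3 * P' ->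
    P * (S0 + (x1 + x2 + x3)) - c * (y1 + y2 + y3) * P' = z1 + z2 + z3.
  by move=> -> -> ->; ring.
have mulD3 (P y1 y2 y3 z1 z2 z3 : Cts) : z1 = P * y1 -> z2 = P * y2 ->
    z3 = P * y3 -> P * (y1 + y2 + y3) = z1 + z2 + z3.
  by move=> -> -> ->; ring.
have f0 : false%:R = 0 :> C by [].
move=> hd [m i|m i||] f; [| | exact: opC1 | exact: opC2].
  rewrite opL; have [-> -> ->] := hd m i; rewrite /Omega !in_tD.
  move: (lambda ^ m) (_ \Po _) (Theta _ _ _) => lam H Th.
  apply: add3.
  - move: (shift _ f) => f'; move: (ddt f') => df.
    by rewrite /cst /t_ /in_t; ring.
  - have [->|m0] := eqVneq m 0.
      by rewrite mul0r shift0; move: (ddt f) => df; rewrite /cst /in_t; ring.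
    by move: (shift _ f) => f'; move: (ddt f') => df; rewrite f0 /cst /in_t; ring.
  have [->|q1] := eqVneq q (-1).
    rewrite mulrN1; move: (shift _ f) => f'; move: (ddt f') => df.
    by rewrite /cst /in_t; ring.
  move: (shift _ f) => f'; move: (ddt f') => df.
  move: (shift _ f) => f''; move: (ddt f'') => df''.
  by rewrite f0 /cst /in_t; ring.
rewrite opW; have [-> _ _] := hd m i; rewrite /Omega !in_tD.
move: (lambda ^ m) => lam; apply: mulD3.
- by move: (shift _ f) => f'; rewrite /cst /t_ /in_t; ring.
- have [->|m0] := eqVneq m 0; first by rewrite mul0r shift0 /cst /in_t; ring.
  by move: (shift _ f) => f'; rewrite f0 /cst /in_t; ring.
have [->|q1] := eqVneq q (-1).
  by rewrite mulrN1; move: (shift _ f) => f'; rewrite /cst /in_t; ring.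
move: (shift _ f) => f'; move: (shift _ f) => f''.
by rewrite f0 /cst /in_t; ring.
Qed.

Lemma op_Omega_n n lambda a b h : q = n%:R^-1 ->
  omega_n_data n lambda a b h w A B ->
  forall k f, op k f = Omega_n n lambda a b h k f.
Proof.
move=> qE hd [m i|m i||] f; [| | exact: opC1 | exact: opC2].
  rewrite opL; have [-> -> ->] := hd m i; rewrite /Omega_n qE.
  move: (shift _ f) => f'; move: (ddt f') => df.
  have tX k : in_t 'X^k = t_ ^+ k by rewrite /t_ /in_t rmorphXn.
  rewrite !in_tD !in_tM !tX exprD expr1.
  move: (t_ ^+ _) (lambda ^ m) (a ^+ i) (a ^+ i.-1) (_ \Po _) => T lam a' a'' H.
  by rewrite /cst /t_ /in_t; ring.
rewrite opW; have [-> _ _] := hd m i; rewrite /Omega_n qE.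
have tX k : in_t 'X^k = t_ ^+ k by rewrite /t_ /in_t rmorphXn.
by rewrite in_tM tX mulrC.
Qed.

End Isomorphism.

Lemma omega_data_beta0 (R : realType) (q lambda alpha : R[i]) beta gamma h w A B :
  q != -1 -> omega_data q lambda alpha beta gamma h w A B ->
  omega_data q lambda alpha (0, 0) gamma h w A B.
Proof.
move=> q1 hd m i; have [-> -> ->] := hd m i; rewrite (negPf q1).
by rewrite !(mulr0, mul0r).
Qed.

Lemma omega_data_gamma0 (R : realType) (q lambda alpha : R[i]) beta gamma h w A B :
  ~ (exists k : nat, - (2%:R * q) = k%:R) ->
  omega_data q lambda alpha beta gamma h w A B ->
  omega_data q lambda alpha beta (0, 0) h w A B.
Proof.
move=> nk hd m i; have [-> -> ->] := hd m i.
have -> : (i%:R == - (2%:R * q)) = false.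
  by apply/negP => /eqP ik; apply: nk; exists i.
by rewrite !(mulr0, mul0r).
Qed.

(** * Transport to a free module of rank one *)

Section FreeModule.
Context (R : realType) (q : R[i]) (M : lmodType R[i]).
Context (act : takiff_block q -> M -> M) (v0 : M) (phi : M -> Cts R).
Context (hM : is_lie_module act).
Local Notation psi u := (Uh_act act u v0).
Context (psiK : cancel (fun u => psi u) phi) (phiK : cancel phi (fun u => psi u)).
Local Notation op := (fun k f => phi (act << k >> (psi f))).

Lemma act_comm v : act << IL 0 0 >> (act << IW 0 0 >> v)
  = act << IW 0 0 >> (act << IL 0 0 >> v).
Proof.
have [lin1 lin2 rel] := hM; apply/eqP; rewrite -subr_eq0 -rel; apply/eqP.
have -> : @lie_br _ (takiff_block q) << IL 0 0 >> << IW 0 0 >> = 0.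
  exact: block_abelian.
by have := lin1 v (-1) 0 0; rewrite scaler0 addr0 scaleN1r addNr.
Qed.

Let actlin x : linear (act x). Proof. by have [_ h _] := hM. Qed.

Lemma psi_linear c u v : psi (cst c * u + v) = c *: psi u + psi v.
Proof. exact: poly_act_linear. Qed.

Lemma psi_s u : psi (s_ R * u) = act << IL 0 0 >> (psi u).
Proof. by apply: poly_act_s; exact: actlin. Qed.

Lemma psi_t u : psi (t_ R * u) = act << IW 0 0 >> (psi u).
Proof. by apply: poly_act_t; [exact: actlin | exact: act_comm]. Qed.

Lemma phi_linear c u v : phi (c *: u + v) = cst c * phi u + phi v.
Proof. by apply: (can_inj psiK); rewrite /= phiK psi_linear !phiK. Qed.

Lemma phiB u v : phi (u - v) = phi u - phi v.
Proof.
have -> : u - v = (-1) *: v + u by rewrite scaleN1r addrC.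
rewrite phi_linear; have -> : cst (-1 : R[i]) = -1 by rewrite /cst !polyCN !polyC1.
by rewrite mulN1r addrC.
Qed.

Let phi0 : phi 0 = 0.
Proof. by rewrite -[0 in LHS](subrr 0) phiB subrr. Qed.

Let act0 v : act 0 v = 0.
Proof.
have [lin1 _ _] := hM; have := lin1 v (-1) 0 0.
by rewrite scaler0 addr0 scaleN1r addNr.
Qed.

Let act_comb v (c d : R[i]) (x y : takiff_block q) :
  phi (act (c *: x + d *: y) v) = cst c * phi (act x v) + cst d * phi (act y v).
Proof.
have [lin1 _ _] := hM; rewrite (lin1 v c) phi_linear.
by have := lin1 v d y 0; rewrite addr0 act0 => ->; rewrite phi_linear phi0 addr0.
Qed.

Let act_br (k l : block_idx) v :
  phi (act << k >> (psi (phi (act << l >> v))))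
  - phi (act << l >> (psi (phi (act << k >> v))))
  = phi (act (block_br0 q k l) v).
Proof.
have [_ _ rel] := hM; rewrite !phiK -phiB -rel.
by congr (phi (act _ v)); exact: block_brU.
Qed.

Let act_br0 k l v : block_br0 q k l = 0 ->
  phi (act << k >> (psi (phi (act << l >> v))))
  = phi (act << l >> (psi (phi (act << k >> v)))).
Proof.
move=> kl; apply/eqP; rewrite -subr_eq0 act_br; apply/eqP.
by rewrite kl act0 phi0.
Qed.

Lemma free_block_module : block_module q op.
Proof.
split.
- move=> k c u v; rewrite psi_linear -phi_linear; congr (phi _).
  exact: actlin.
- by move=> f; rewrite -psi_s psiK.
- by move=> f; rewrite -psi_t psiK.
- move=> m i n j f; have e1 := act_br (IL m i) (IL n j) (psi f).
  have e2 := act_comb (psi f) (block_coef q m i n j) (block_cocycle R m i n j)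
    << IL (m + n) (i + j)%N >> << IC1 >>.
  exact: etrans e1 e2.
- move=> m i n j f; have e1 := act_br (IL m i) (IW n j) (psi f).
  have e2 := act_comb (psi f) (block_coef q m i n j) (block_cocycle R m i n j)
    << IW (m + n) (i + j)%N >> << IC2 >>.
  exact: etrans e1 e2.
- by move=> m i n j f; exact: act_br0.
- by move=> k f; apply: act_br0; case: k.
- by move=> k f; apply: act_br0; case: k.
Qed.

(** The action is linear in the algebra element, so agreement on the basis suffices. *)
Lemma free_iso (Om : block_idx -> Cts R -> Cts R) :
  (forall k f, op k f = Om k f) -> iso_Cts act Om.
Proof.
move=> opE; have [lin1 _ _] := hM.
exists phi; split; [by exists (fun u => psi u) | exact: phi_linear |].
move=> x v; have -> : act x v = linext (fun k => act << k >> v) x.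
  apply: (malg_linP (f := fun y => act y v) (lin1 v) (linext_linear _)) => k.
  by rewrite linextU.
have phiD : {morph phi : u w / u + w}.
  move=> u w; have := phi_linear 1 u w; rewrite scale1r => ->.
  by rewrite /cst !polyC1 mul1r.
rewrite /linext (big_morph phi phiD phi0); apply: eq_bigr => k _.
by rewrite -opE phiK -[X in phi X]addr0 phi_linear phi0 addr0.
Qed.

End FreeModule.

(** * The classification *)

Lemma block_module_classification (R : realType) (q : R[i])
    (op : block_idx -> Cts R -> Cts R) : q != 0 -> block_module q op ->
  exists w A B, [/\
    (forall m i f, op (IW m i) f = shift (m%:~R * q) f * in_t (w m i))
    /\ (forall m i f, op (IL m i) f
      = shift (m%:~R * q) f * (s_ R * in_t (A m i) + in_t (B m i))
        - cst (m%:~R * q) * in_t (w m i) * ddt (shift (m%:~R * q) f)),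
    (forall f, op IC1 f = 0) /\ (forall f, op IC2 f = 0)
    & exists2 lambda, lambda != 0 &
      (exists n, [/\ (0 < n)%N, q = n%:R^-1 & exists a b h,
         Tset 0 h /\ omega_n_data n lambda a b h w A B])
      \/ exists alpha beta gamma h,
         Tset alpha h /\ omega_data q lambda alpha beta gamma h w A B].
Proof.
move=> q0 bm; have vd := block_module_unit_data bm.
have [z1 z2 cls] := block_data_classification q0 (unit_block_data q0 vd).
have central k z f : k = IC1 \/ k = IC2 -> op k 1 = cst z -> z = 0 -> op k f = 0.
  move=> hk kz z0; apply: (etrans (op_central bm f hk)).
  by rewrite kz z0 /cst !polyC0 mulr0.
exists (fun m i => (op (IW m i) 1)`_0), (fun m i => (op (IL m i) 1)`_1),
  (fun m i => (op (IL m i) 1)`_0); split=> //.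
- split=> m i f.
    exact: etrans (op_IW bm m i f)
      (congr1 (fun z => shift _ f * z) (ud_W_in_t q0 vd m i)).
  exact: etrans (op_IL bm m i f)
    (congr2 (fun y z => shift _ f * y - cst _ * z * ddt (shift _ f))
       (ud_L_affine q0 vd m i) (ud_W_in_t q0 vd m i)).
- split=> f.
    exact: central (or_introl erefl) (ud_Z_cst q0 vd (or_introl erefl)) z1.
  exact: central (or_intror erefl) (ud_Z_cst q0 vd (or_intror erefl)) z2.
Qed.

Theorem theorem3p14 (R : realType) (q : R[i]) (hq : q != 0)
    (M : lmodType R[i]) (act : takiff_block q -> M -> M)
    (hM : is_lie_module act) (hfree : Uh_free_rank1 act) :
  [\/ (~ exists k : nat, - (2%:R * q) = k%:R) /\
      (exists (lambda alpha : R[i]) (h : int -> {poly R[i]}),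
         [/\ lambda != 0, Tset alpha h
           & iso_Cts act (Omega q lambda alpha (0, 0) (0, 0) h)]),
      (exists n : nat,
         [/\ (0 < n)%N, q = n%:R^-1
           & exists (lambda a b : R[i]) (h : int -> {poly R[i]}),
               [/\ lambda != 0, Tset 0 h
                 & iso_Cts act (Omega_n n lambda a b h)]]),
      [/\ exists k : nat, - (2%:R * q) = k%:R, q != - 1
        & exists (lambda alpha : R[i]) (gamma : R[i] * R[i])
                 (h : int -> {poly R[i]}),
            [/\ lambda != 0, Tset alpha h
              & iso_Cts act (Omega q lambda alpha (0, 0) gamma h)]]
    | q = - 1 /\
      (exists (lambda alpha : R[i]) (beta gamma : R[i] * R[i])
              (h : int -> {poly R[i]}),
         [/\ lambda != 0, Tset alpha h
           & iso_Cts act (Omega q lambda alpha beta gamma h)])].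
Proof.
have [v0 [phi psiK phiK]] := hfree.
have [op [bm iso]] : exists op, block_module q op /\
    forall Om, (forall k f, op k f = Om k f) -> iso_Cts act Om.
  exists (fun k f => phi (act << k >> (Uh_act act f v0))).
  split; [exact: (free_block_module hM psiK phiK) | exact: (free_iso hM psiK phiK)].
have [w [A [B [[opW opL] [C1 C2] [lambda l0 cls]]]]] :=
  block_module_classification hq bm.
case: cls => [[n [n0 qE [a [b [h [hT hd]]]]]]|[alpha [beta [gamma [h [hT hd]]]]]].
  apply: Or42; exists n; split=> //; exists lambda, a, b, h; split=> //.
  by apply: iso; apply: op_Omega_n hd.
have isoO be ga : omega_data q lambda alpha be ga h w A B ->
    iso_Cts act (Omega q lambda alpha be ga h).
  by move=> hd'; apply: iso; apply: op_Omega hd'.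
have [q1|q1] := eqVneq q (-1).
  apply: Or44; split=> //; exists lambda, alpha, beta, gamma, h.
  by split=> //; exact: isoO.
(* Away from [q = -1] the coefficient of [beta] is zero, so [beta] may be taken to be [(0, 0)];
   likewise [gamma] below when [- 2q] is not a natural number. *)
have {}hd := omega_data_beta0 q1 hd.
have [hk|hk] := EM (exists k : nat, - (2%:R * q) = k%:R).
  apply: Or43; split=> //; exists lambda, alpha, gamma, h.
  by split=> //; exact: isoO.
apply: Or41; split=> //; exists lambda, alpha, h; split=> //.
by apply: isoO; exact: omega_data_gamma0 hk hd.
Qed.
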